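(* Every self-replicating group of abelian wreath type is either virtually abelian or not elementary amenable.
   Context: Let $X$ be a finite set with $|X|\ge 2$, let $X^*$ be the free monoid on $X$, viewed as a rooted tree (its Cayley graph), and let $\mathrm{Aut}(X^* )$ be the group of bijections $g$ of $X^*$ such that $a$ is a prefix of $b$ if and only if $g(a)$ is a prefix of $g(b)$. For $g\in\mathrm{Aut}(X^* )$ and $w\in X^*$, the section $g_w\in \mathrm{Aut}(X^* )$ is the automorphism determined by $g(wu)=g(w)g_w(u)$ for all $u\in X^*$. Let $\pi_1:\mathrm{Aut}(X^* )\to\mathrm{Sym}(X)$ be the homomorphism induced by the action on $X$. View $\mathrm{Sym}(X)\le\mathrm{Aut}(X^* )$ by letting $\sigma\in\mathrm{Sym}(X)$ act by $\sigma(xw)=\sigma(x)w$ for $x\in X$, $w\in X^*$. A group $G\le \mathrm{Aut}(X^* )$ is self-similar if $g_w\in G$ for all $g\in G$, $w\in X^*$; a subset $Y\subseteq\mathrm{Aut}(X^* )$ is self-similar if $g_x\in Y$ for all $g\in Y$, $x\in X$. $G$ is self-replicating if it is self-similar, acts transitively on $X$, and $\{g_x\mid g\in G,\ g(x)=x\}=G$ for all $x\in X$. $G\le\mathrm{Aut}(X^* )$ is of abelian wreath type if $\pi_1(G)\le\mathrm{Sym}(X)$ is abelian and $G$ admits a finite self-similar generating set $Y$ such that for every $g\in Y$ either $g_x=1$ for all $x\in X$, or $g_x\in\{g\}\cup\pi_1(G)$ for all $x\in X$ with exactly one $x\in X$ such that $g_x=g$. The class of elementary amenable groups is the smallest class of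 groups containing all finite groups and all abelian groups and closed under taking subgroups, quotients, group extensions, and direct limits. *)

(* Defs.v *)
From HB Require Import structures.
From mathcomp Require Import all_boot all_order all_fingroup.
From mathcomp Require Import boolp classical_sets functions cardinality.

Set Implicit Arguments.
Unset Strict Implicit.
Unset Printing Implicit Defensive.

Local Open Scope group_scope.

(* Possibly infinite groups are MathComp's groupType, and the subgroups of
   gT : groupType are the predicates G : groupClosed gT. *)

Record subgroup_of (gT : groupType) (G : groupClosed gT) := SubgroupOf {
  subgroup_val :> gT;
  _ : subgroup_val \in G
}.

Section SubgroupOf.
Variables (gT : groupType) (G : groupClosed gT).

HB.instance Definition _ := [isSub for @subgroup_val gT G].
HB.instance Definition _ := [Choice of subgroup_of G by <:].

Fact subgroup_of_closed : group_closed G.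
Proof. by split=> [|x y Gx Gy]; [exact: gpred1 | rewrite gpredM ?gpredV]. Qed.

HB.instance Definition _ :=
  SubChoice_isSubGroup.Build gT _ (subgroup_of G) subgroup_of_closed.
End SubgroupOf.

Definition generates (gT : groupType) (Y : set gT) (G : groupClosed gT) : Prop :=
  (forall y, Y y -> y \in G) /\
  (forall H : groupClosed gT, (forall y, Y y -> y \in H) -> {subset G <= H}).

Definition finite_index (gT : groupType) (A : groupClosed gT) : Prop :=
  finite_set (range (fun x : gT => [set y | y * x^-1 \in A]%classic)).

Definition virtually_abelian (gT : groupType) : Prop :=
  exists2 A : groupClosed gT, {in A &, forall x y, commute x y} & finite_index A.

Definition surjective (aT rT : Type) (f : aT -> rT) : Prop :=
  forall y, exists x, f x = y.

Record directed_system (d : Order.disp_t) (I : porderType d) := DirectedSystem {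
  index_inhabited : inhabited I;
  index_directed : forall i j : I, exists k : I, (i <= k)%O /\ (j <= k)%O;
  ds_group :> I -> groupType;
  ds_map (i j : I) : (i <= j)%O -> {multiplicative ds_group i -> ds_group j};
  ds_map_id : forall (i : I) (le_ii : (i <= i)%O) x, ds_map le_ii x = x;
  ds_map_comp : forall (i j k : I) (le_ij : (i <= j)%O) (le_jk : (j <= k)%O)
    (le_ik : (i <= k)%O) x, ds_map le_jk (ds_map le_ij x) = ds_map le_ik x
}.

Arguments ds_map {d I} S {i j} le_ij : rename.

(* L, with the canonical maps f i, is (isomorphic to) the disjoint union of the
   groups S i modulo the identification of x and y whenever they have the same
   image in some S k: the usual construction of the direct limit of S. *)
Definition is_direct_limit (d : Order.disp_t) (I : porderType d)
    (S : directed_system I) (L : groupType)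
    (f : forall i, {multiplicative S i -> L}) : Prop :=
  [/\ forall (i j : I) (le_ij : (i <= j)%O) x, f j (ds_map S le_ij x) = f i x,
      forall y : L, exists i, exists x : S i, f i x = y &
      forall (i j : I) (x : S i) (y : S j), f i x = f j y ->
        exists k, exists le_ik : (i <= k)%O, exists le_jk : (j <= k)%O,
          ds_map S le_ik x = ds_map S le_jk y].

(* Subgroups and quotients are taken up to isomorphism, as injective,
   respectively surjective, homomorphisms. *)
Inductive elementary_amenable : groupType -> Prop :=
| EA_finite (G : groupType) :
    finite_set [set: G]%classic -> elementary_amenable G
| EA_abelian (G : groupType) :
    (forall x y : G, commute x y) -> elementary_amenable G
| EA_subgroup (H G : groupType) (i : {multiplicative H -> G}) :
    injective i -> elementary_amenable G -> elementary_amenable H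
| EA_quotient (G Q : groupType) (p : {multiplicative G -> Q}) :
    surjective p -> elementary_amenable G -> elementary_amenable Q
| EA_extension (N G Q : groupType)
    (i : {multiplicative N -> G}) (p : {multiplicative G -> Q}) :
    injective i -> surjective p ->
    (forall x, p x = 1 <-> exists n, i n = x) ->
    elementary_amenable N -> elementary_amenable Q -> elementary_amenable G
| EA_direct_limit (d : Order.disp_t) (I : porderType d) (S : directed_system I)
    (L : groupType) (f : forall i, {multiplicative S i -> L}) :
    is_direct_limit f ->
    (forall i, elementary_amenable (S i)) -> elementary_amenable L.

Definition is_tree_aut (X : finType) (g : seq X -> seq X) : Prop :=
  bijective g /\ forall a b, prefix a b <-> prefix (g a) (g b).

Record tree_aut (X : finType) := TreeAut {
  tree_aut_fun :> seq X -> seq X;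
  tree_aut_subproof : `[< is_tree_aut tree_aut_fun >]
}.

HB.instance Definition _ (X : finType) := [isSub for @tree_aut_fun X].
HB.instance Definition _ (X : finType) := [Choice of tree_aut X by <:].

Section TreeAut.
Variable X : finType.
Implicit Types (g h : tree_aut X) (a b w u : seq X) (x : X).

Definition to_tree_aut (f : seq X -> seq X) (Pf : is_tree_aut f) : tree_aut X :=
  TreeAut (asboolT Pf).

Lemma tree_autP g : is_tree_aut g.
Proof. exact: asboolW (tree_aut_subproof g). Qed.

Lemma tree_aut_ext g h : g =1 h -> g = h.
Proof. by move=> gh; apply/val_inj/funext. Qed.

Lemma tree_aut_inj g : injective g.
Proof. exact: bij_inj (tree_autP g).1. Qed.

Lemma tree_aut_surj g w : exists u, g u = w.
Proof. by have [[f _ fK] _] := tree_autP g; exists (f w). Qed.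

Lemma tree_aut_prefix g a b : prefix (g a) (g b) = prefix a b.
Proof. by have [_ /(_ a b)[ab ba]] := tree_autP g; apply/idP/idP. Qed.

Lemma one_is_tree_aut : is_tree_aut (@id (seq X)).
Proof. by split; first by exists id. Qed.

(* (g * h) w = h (g w), as in MathComp's {perm X}, so that pi1 and rooted
   below are homomorphisms. *)
Lemma mul_is_tree_aut g h : is_tree_aut (h \o g).
Proof.
split; first exact: bij_comp (tree_autP h).1 (tree_autP g).1.
by move=> a b; rewrite /= !tree_aut_prefix.
Qed.

Lemma inv_subproof g : exists f, cancel g f /\ cancel f g.
Proof. by have [[f gK fK] _] := tree_autP g; exists f. Qed.

Definition inv_fun g : seq X -> seq X := projT1 (cid (inv_subproof g)).

Lemma inv_funK g : cancel g (inv_fun g).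
Proof. exact: (projT2 (cid (inv_subproof g))).1. Qed.

Lemma inv_funKV g : cancel (inv_fun g) g.
Proof. exact: (projT2 (cid (inv_subproof g))).2. Qed.

Lemma inv_is_tree_aut g : is_tree_aut (inv_fun g).
Proof.
split; first by exists g; [exact: inv_funKV | exact: inv_funK].
by move=> a b; rewrite -(tree_aut_prefix g (inv_fun g a)) !inv_funKV.
Qed.

Definition tree_aut_one := to_tree_aut one_is_tree_aut.
Definition tree_aut_mul g h := to_tree_aut (mul_is_tree_aut g h).
Definition tree_aut_inv g := to_tree_aut (inv_is_tree_aut g).

Fact tree_aut_mulA : associative tree_aut_mul.
Proof. by move=> g h k; apply: tree_aut_ext. Qed.
Fact tree_aut_mul1 : left_id tree_aut_one tree_aut_mul.
Proof. by move=> g; apply: tree_aut_ext. Qed.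
Fact tree_aut_mulr1 : right_id tree_aut_one tree_aut_mul.
Proof. by move=> g; apply: tree_aut_ext. Qed.
Fact tree_aut_mulV : left_inverse tree_aut_one tree_aut_inv tree_aut_mul.
Proof. by move=> g; apply: tree_aut_ext => w; exact: inv_funKV. Qed.
Fact tree_aut_mulrV : right_inverse tree_aut_one tree_aut_inv tree_aut_mul.
Proof. by move=> g; apply: tree_aut_ext => w; exact: inv_funK. Qed.

HB.instance Definition _ := isGroup.Build (tree_aut X)
  tree_aut_mulA tree_aut_mul1 tree_aut_mulr1 tree_aut_mulV tree_aut_mulrV.

Definition section_fun g w u := drop (size (g w)) (g (w ++ u)).

Lemma section_funE g w u : g (w ++ u) = g w ++ section_fun g w u.
Proof.
have: prefix (g w) (g (w ++ u)) by rewrite tree_aut_prefix prefix_prefix.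
by case/prefixP=> v Ev; rewrite /section_fun Ev drop_size_cat.
Qed.

Lemma section_is_tree_aut g w : is_tree_aut (section_fun g w).
Proof.
have pre u v : prefix (section_fun g w u) (section_fun g w v) = prefix u v.
  have := tree_aut_prefix g (w ++ u) (w ++ v).
  by rewrite !section_funE !prefix_catr // !eqxx.
split; last by move=> u v; rewrite pre.
rewrite -setTT_bijective; split=> // [u v _ _ E | v _].
  have /tree_aut_inj/eqP : g (w ++ u) = g (w ++ v) by rewrite !section_funE E.
  by rewrite eqseq_cat // eqxx => /eqP.
have [z Ez] := tree_aut_surj g (g w ++ v).
have : prefix (g w) (g z) by rewrite Ez prefix_prefix.
rewrite tree_aut_prefix => /prefixP[u Eu]; exists u => //.
by apply/eqP; rewrite /section_fun -Eu Ez drop_size_cat.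
Qed.

Definition section g w : tree_aut X := to_tree_aut (section_is_tree_aut g w).

Lemma sectionE g w u : g (w ++ u) = g w ++ section g w u.
Proof. exact: section_funE. Qed.

Lemma tree_aut_nil g : g [::] = [::].
Proof.
have [z Ez] := tree_aut_surj g [::].
by apply/eqP; rewrite -prefixs0 -{2}Ez tree_aut_prefix prefix0s.
Qed.

Lemma tree_aut_letter g x : exists y, g [:: x] = [:: y].
Proof.
case E: (g [:: x]) => [|y s].
  by have := tree_aut_inj (etrans E (esym (tree_aut_nil g))).
exists y; rewrite -E; have [z Ez] := tree_aut_surj g [:: y].
have : prefix (g z) (g [:: x]) by rewrite Ez E prefix_cons eqxx prefix0s.
rewrite tree_aut_prefix prefixs1 => /orP[] /eqP Dz.
  by move: Ez; rewrite Dz tree_aut_nil.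
by rewrite -Dz.
Qed.

Definition pi1_fun g x : X := head x (g [:: x]).

Lemma pi1_funE g x : g [:: x] = [:: pi1_fun g x].
Proof. by rewrite /pi1_fun; have [y ->] := tree_aut_letter g x. Qed.

Lemma pi1_fun_inj g : injective (pi1_fun g).
Proof.
move=> x y E; have /tree_aut_inj[] // : g [:: x] = g [:: y].
by rewrite !pi1_funE E.
Qed.

Definition pi1 g : {perm X} := perm (@pi1_fun_inj g).

Lemma pi1E g x : g [:: x] = [:: pi1 g x].
Proof. by rewrite permE pi1_funE. Qed.

Fact pi1M : {morph pi1 : g h / g * h}.
Proof.
move=> g h; apply/permP=> x; rewrite permM.
have : (g * h) [:: x] = h (g [:: x]) by [].
by rewrite !pi1E => -[].
Qed.

HB.instance Definition _ := isMultiplicative.Build (tree_aut X) {perm X} pi1 pi1M.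

Definition rooted_fun (s : {perm X}) w : seq X :=
  if w is x :: u then s x :: u else [::].

Lemma rooted_is_tree_aut (s : {perm X}) : is_tree_aut (rooted_fun s).
Proof.
split; last by case=> [|x a] [|y b] //=; rewrite (inj_eq (@perm_inj _ s)).
exists (rooted_fun s^-1); first by case=> //= x u; rewrite permK.
by case=> //= x u; rewrite permKV.
Qed.

Definition rooted (s : {perm X}) : tree_aut X := to_tree_aut (rooted_is_tree_aut s).

Fact rootedM : {morph rooted : s t / s * t}.
Proof. by move=> s t; apply: tree_aut_ext => -[|x u] //=; rewrite permM. Qed.

HB.instance Definition _ :=
  isMultiplicative.Build {perm X} (tree_aut X) rooted rootedM.

Implicit Types (G : groupClosed (tree_aut X)) (Y : set (tree_aut X)).

Definition pi1_image G : {set {perm X}} :=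
  [set s | `[< exists2 g, g \in G & pi1 g = s >]].

Definition self_similar_group G : Prop :=
  forall g w, g \in G -> section g w \in G.

Definition self_similar_set Y : Prop :=
  forall g x, Y g -> Y (section g [:: x]).

Definition letter_transitive G : Prop :=
  forall x y, exists2 g, g \in G & pi1 g x = y.

Definition self_replicating G : Prop :=
  [/\ self_similar_group G, letter_transitive G &
      forall x h, (exists g, [/\ g \in G, g [:: x] = [:: x] & section g [:: x] = h])
                  <-> h \in G].

Definition abelian_wreath_generator G g : Prop :=
  (forall x, section g [:: x] = 1) \/
  ((forall x, section g [:: x] = g \/
              exists2 s, s \in pi1_image G & section g [:: x] = rooted s) /\
   exists! x, section g [:: x] = g).

Definition abelian_wreath_type G : Prop :=
  abelian (pi1_image G) /\
  exists Y, [/\ finite_set Y, self_similar_set Y, generates Y G &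
                forall g, Y g -> abelian_wreath_generator G g].
End TreeAut.

(* Main.v *)
Require Import Defs.
From mathcomp Require Import all_boot all_order all_fingroup all_algebra cyclic zify.
From mathcomp Require Import boolp classical_sets functions cardinality.
From HB Require Import structures.

Set Implicit Arguments.
Unset Strict Implicit.
Unset Printing Implicit Defensive.

Local Open Scope classical_set_scope.
Local Open Scope group_scope.

Local Notation "x / y" := (x * y^-1) : group_scope.

(** Let G be a self-replicating group of abelian wreath type that is not
    virtually abelian. For a subgroup H of G, let sigma H be the group of
    sections at a fixed letter x0 of the elements of H that act trivially on X.
    As pi1 G is abelian and transitive, it acts regularly on X, so the
    stabiliser of one letter fixes every letter; as G is self-replicating,
    sigma G = G, and sigma maps normal subgroups to normal subgroups that do
    not depend on x0.

    The core of the proof is [descent]: if L has finite index in G and M is a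
    subgroup containing all commutators of L, then some sigma^n M has finite
    index in G. Replace L by its normal core, then by the sigma^i L of smallest
    index: from there on every sigma^i L is transitive on X. Since G is finitely
    generated it has finitely many subgroups of bounded index, so after another
    shift sigma^p L = L with p > 0. The groups sigma^(j p) [L, L] then increase
    with j; let K be their union, so that sigma^p K = K. If K has finite index
    it is finitely generated, hence equal to one of the sigma^(j p) [L, L].

    The remaining case, an infinite abelian group L / K, is excluded by
    comparing two estimates ([periodic_fin_idx]). Let F be a nonzero integral
    character of L that kills K, and let the directed length of g be the number
    of directed generators in a word for g, the rooted ones being free. A
    directed generator has itself as its only section that is not rooted, so
    the directed lengths of the first-level sections of g add up to at most
    that of g ([directed_len_sec]). A character F of (sigma L) / (sigma K) pulls
    back to a character F' of L / K: for u in L take c = #|pi1 G : pi1 K| and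
    k in K such that k u^c fixes X, and let F' u be the value of F at the section
    of k u^c at x0. This F' is integral, and summing over the |X| sections of
    u^(c m), with m = #|pi1 K|, shows that the linear bound of F' in the directed
    length is m times smaller than the one of F ([pull]). As K is nontrivial, it
    acts nontrivially on X after some sections are taken, so the factor obtained
    after p steps, or a multiple of p, is at least 2. Iterating over more and
    more periods produces nonzero integral characters of L that are bounded by
    arbitrarily small numbers on a fixed finite generating set.

    Elementary amenability enters through a property of a group H that is
    stable under all the closure operations ([rich_fibers]): for every subgroup
    R of H x G whose projection to G has finite index, the fiber M of R over 1
    is such that some sigma^n M has finite index in G. For abelian H this is
    [descent]. An extension N -> H -> Q is treated by applying the property
    of Q to the image of R, which moves R into N x G after replacing its values
    by their sections. A subgroup of finite index is finitely generated, which
    settles direct limits. If G were elementary amenable, R could be taken to be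
    the diagonal, whose fiber is trivial, and G would be finite, hence virtually
    abelian. *)

(** * Subgroups, finite index and finite generation *)

(** Subgroups are sets rather than [groupClosed] predicates, so that unions,
    images and fibers need no packaging. *)
Record is_subgroup (gT : groupType) (H : set gT) : Prop := IsSubgroup {
  sg1 : H 1;
  sgM : forall x y, H x -> H y -> H (x * y);
  sgV : forall x, H x -> H x^-1
}.

Section GroupSets.
Variable gT : groupType.
Implicit Types (G H K L M : set gT) (g h u v x y : gT).

Lemma sgD H x y : is_subgroup H -> H x -> H y -> H (x / y).
Proof. by move=> sH Hx Hy; apply: (sgM sH) => //; apply: (sgV sH). Qed.

Lemma sgX H x n : is_subgroup H -> H x -> H (x ^+ n).
Proof.
move=> sH Hx; elim: n => [|n IHn]; first exact: (sg1 sH).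
by rewrite expgS; apply: (sgM sH).
Qed.

Lemma sgMr H x y : is_subgroup H -> H y -> H (x * y) <-> H x.
Proof.
move=> sH Hy; split=> [Hxy|Hx]; last exact: sgM.
by rewrite -(mulgK y x); apply: sgD.
Qed.

Lemma sgMl H x y : is_subgroup H -> H x -> H (x * y) <-> H y.
Proof.
move=> sH Hx; split=> [Hxy|Hy]; last exact: sgM.
by rewrite -(mulKg x y); apply: sgM => //; apply: sgV.
Qed.

Lemma sgDC H x y : is_subgroup H -> H (x / y) -> H (y / x).
Proof. by move=> sH /(sgV sH); rewrite invgF. Qed.

Lemma sgJ H x y : is_subgroup H -> H x -> H y -> H (x ^ y).
Proof.
by move=> sH Hx Hy; rewrite conjgE; do ?apply: sgM => //; apply: sgV.
Qed.

(** At most n cosets of H meet L, expressed without a quotient: the elements of L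
    are labelled so that equal labels force the same right coset of H. *)
Definition labels (L H : set gT) (n : nat) : Prop :=
  exists phi : gT -> 'I_n, forall g h, L g -> L h -> phi g = phi h -> H (g / h).

Definition fin_idx (L H : set gT) : Prop := exists n, labels L H n.

Lemma labels_fin (F : finType) (phi : gT -> F) L H :
  (forall g h, L g -> L h -> phi g = phi h -> H (g / h)) -> labels L H #|F|.
Proof.
move=> phiP; exists (enum_rank \o phi) => g h Lg Lh /enum_rank_inj.
exact: phiP.
Qed.

Lemma labels_sub L H H' n : H `<=` H' -> labels L H n -> labels L H' n.
Proof. by move=> sHH' [phi phiP]; exists phi => g h Lg Lh /phiP-/(_ Lg Lh)/sHH'. Qed.

Lemma fin_idx_sub L H H' : H `<=` H' -> fin_idx L H -> fin_idx L H'.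
Proof. by move=> sHH' [n labn]; exists n; apply: labels_sub labn. Qed.

(** Only the labels carried by elements of G have representatives, hence the
    formulation through phi g. *)
Lemma label_repr n (phi : gT -> 'I_n) G : exists r : 'I_n -> gT,
  forall g, G g -> G (r (phi g)) /\ phi (r (phi g)) = phi g.
Proof.
have /choice[r rP] : forall i : 'I_n, exists x,
    forall g, G g -> phi g = i -> G x /\ phi x = i.
  move=> i; have [[g [Gg <-]]|noi] := pselect (exists g, G g /\ phi g = i).
    by exists g.
  by exists 1 => g Gg gi; case: noi; exists g.
by exists r => g Gg; exact: (rP _ g Gg).
Qed.

Lemma fin_idx_trans G L K : fin_idx G L -> fin_idx L K -> fin_idx G K.
Proof.
move=> [n [phi phiP]] [k [psi psiP]].
have [r rP] := label_repr phi G.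
have fitG g : G g -> L (g / r (phi g)).
  by move=> Gg; have [Gr Er] := rP g Gg; apply: phiP.
eexists; apply: (@labels_fin _ (fun g => (phi g, psi (g / r (phi g))))).
move=> g h Gg Gh [Ephi Epsi].
have -> : g / h = (g / r (phi g)) / (h / r (phi h)) by rewrite Ephi !gnorm.
by apply: psiP => //; exact: fitG.
Qed.

Lemma fin_idx_id L : is_subgroup L -> fin_idx L L.
Proof.
move=> sL; eexists; apply: (@labels_fin _ (fun=> tt)) => g h Lg Lh _.
exact: sgD.
Qed.

(** Two of the powers u^0, ..., u^n carry the same of the n labels. *)
Lemma fin_idx_expg L H : is_subgroup L -> fin_idx L H ->
  exists2 N, 0 < N & forall u, L u -> exists2 k, 0 < k <= N & H (u ^+ k).
Proof.
move=> sL [n [phi phiP]]; exists n.+1 => // u Lu.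
have : ~~ injectiveb (fun i : 'I_n.+1 => phi (u ^+ i)).
  by apply/negP => /injectiveP /leq_card; rewrite !card_ord ltnn.
move=> /injectivePn[i [j neij Eij]].
wlog ltij : i j neij Eij / i < j.
  move=> IH; have /orP[ltij|ltji] : (i < j) || (j < i).
  - by rewrite -neq_ltn.
  - exact: (IH i j).
  - by apply: (IH j i) => //; rewrite eq_sym.
exists (j - i); first by rewrite subn_gt0 ltij (leq_trans (leq_subr _ _)) ?(ltnW (ltn_ord j)).
by rewrite expgnFr ?(ltnW ltij) //; apply: phiP => //; apply: sgX.
Qed.

Definition normal_in (L H : set gT) : Prop :=
  [/\ is_subgroup H, H `<=` L & forall u g, H u -> L g -> H (u ^ g)].

Definition core (G L : set gT) : set gT :=
  [set g | G g /\ forall h, G h -> L (g ^ h)].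

Lemma core_normal G L : is_subgroup G -> is_subgroup L -> normal_in G (core G L).
Proof.
move=> sG sL; split=> [|g []//|].
  split; first by split=> [|h _]; [exact: sg1 | rewrite conj1g; exact: sg1].
    move=> x y [Gx Lx] [Gy Ly]; split; first exact: sgM.
    by move=> h Gh; rewrite conjMg; apply: sgM; auto.
  move=> x [Gx Lx]; split; first exact: sgV.
  by move=> h Gh; rewrite conjVg; apply: sgV; auto.
move=> u g [Gu Lu] Gg; split=> [|h Gh]; first exact: sgJ.
by rewrite -conjgM; apply: Lu; apply: sgM.
Qed.

Lemma core_sub G L : is_subgroup G -> core G L `<=` L.
Proof. by move=> sG g [Gg /(_ 1 (sg1 sG))]; rewrite conjg1. Qed.

(** An element g is labelled by its permutation action on the cosets of L,
    recorded on coset representatives. *)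
Lemma core_fin_idx G L : is_subgroup G -> is_subgroup L ->
  fin_idx G L -> fin_idx G (core G L).
Proof.
move=> sG sL [n [phi phiP]]; have [r rP] := label_repr phi G.
eexists; apply: (@labels_fin _ (fun g => [ffun i : 'I_n => phi (r i * g)])).
move=> g g' Gg Gg' /ffunP E; split=> [|h Gh]; first exact: sgD.
have [Gr Er] := rP _ (sgV sG Gh); set i := phi h^-1 in Gr Er *.
have Lhr : L (h^-1 / r i) by apply: phiP => //; apply: sgV.
have Lgg : L (r i * g / (r i * g')).
  by apply: phiP; [apply: sgM..|have := E i; rewrite !ffunE].
have -> : (g / g') ^ h = (h^-1 / r i) * (r i * g / (r i * g')) * (h^-1 / r i)^-1.
  by rewrite conjgE !gnorm.
by apply: sgD => //; apply: sgM.
Qed.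

Definition generated_by (s : seq gT) (L : set gT) : Prop :=
  (forall x, x \in s -> L x) /\
  forall H, is_subgroup H -> (forall x, x \in s -> H x) -> L `<=` H.

Definition fin_gen (L : set gT) : Prop := exists s, generated_by s L.

(** Words over s are lists of elements of the finite type [seq_sub s], which lets
    them be read by a finite automaton. *)
Definition word (s : seq gT) (w : seq (seq_sub s)) : gT :=
  foldl (fun g (e : seq_sub s) => g * ssval e) 1 w.

Lemma word_rcons (s : seq gT) w (e : seq_sub s) : word (rcons w e) = word w * ssval e.
Proof. exact: foldl_rcons. Qed.

Lemma word_cat (s : seq gT) (w1 w2 : seq (seq_sub s)) :
  word (w1 ++ w2) = word w1 * word w2.
Proof.
elim/last_ind: w2 => [|w2 e IH]; first by rewrite cats0 mulg1.
by rewrite -rcons_cat !word_rcons IH mulgA.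
Qed.

Lemma fin_gen_word L : is_subgroup L -> fin_gen L ->
  exists s : seq gT, (forall x, x \in s -> L x) /\
    forall g, L g -> exists w : seq (seq_sub s), g = word w.
Proof.
move=> sL [s0 [Ls0 genL]]; pose s := s0 ++ [seq x^-1 | x <- s0]; exists s.
have sV x : x \in s -> x^-1 \in s.
  rewrite !mem_cat => /orP[sx|/mapP[y sy ->]]; first by
    rewrite (map_f (fun x : gT => x^-1)) ?orbT.
  by rewrite invgK sy.
split.
  by move=> x; rewrite mem_cat => /orP[/Ls0//|/mapP[y /Ls0 Ly ->]]; exact: sgV.
apply: genL; last first.
  move=> x s0x; have sx : x \in s by rewrite mem_cat s0x.
  by exists [:: SeqSub sx]; rewrite /word /= mul1g.
split; first by exists [::].
  by move=> _ _ [w1 ->] [w2 ->]; exists (w1 ++ w2); rewrite word_cat.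
move=> _ [w ->]; exists (rev [seq SeqSub (sV _ (ssvalP e)) | e : seq_sub s <- w]).
elim/last_ind: w => [|w e IH]; first by rewrite invg1.
by rewrite map_rcons rev_rcons word_rcons invgM IH -cat1s word_cat /word /= mul1g.
Qed.

Section Automaton.
Variables (s : seq gT) (n : nat).

(** The triple is the initial state, the transition function and the accepting
    states of a deterministic automaton over the alphabet s. *)
Definition automaton := ('I_n * {ffun 'I_n * seq_sub s -> 'I_n} * {set 'I_n})%type.

Definition run (d : automaton) (w : seq (seq_sub s)) : 'I_n :=
  foldl (fun i e => d.1.2 (i, e)) d.1.1 w.

Definition lang (d : automaton) (g : gT) : Prop :=
  exists2 w, g = word w & run d w \in d.2.

(** The coset automaton of L: its states are coset labels, r picks a
    representative of each, and reading a word w from the label of 1 leads to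
    the label of the coset of w. It serves both to recover L from finite data
    and to write down Schreier generators. *)
Lemma automatonP (G L : set gT) :
  is_subgroup G -> is_subgroup L -> L `<=` G ->
  (forall x, x \in s -> G x) ->
  labels G L n -> exists (d : automaton) (r : 'I_n -> gT),
   [/\ L (r d.1.1), forall i e, G (r i) -> L (r i * ssval e / r (d.1.2 (i, e))) &
     (forall w, G (r (run d w)) /\ L (word w / r (run d w))) /\
      forall i, (i \in d.2) <-> L (r i)].
Proof.
move=> sG sL sLG Gs [phi phiP]; have [r rP] := label_repr phi G.
have rL g : G g -> L (g / r (phi g)).
  by move=> Gg; have [Gr Er] := rP g Gg; apply: phiP.
pose d : automaton := (phi 1, [ffun ix => phi (r ix.1 * ssval ix.2)],
   [set i | `[<L (r i)>]]%SET).
have G1 := sg1 sG.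
exists d, r; split.
- by have := sgV sL (rL _ (sg1 sG)); rewrite invgF divg1.
- by move=> i e Gri /=; rewrite ffunE; apply: rL; apply: sgM => //; apply: Gs; apply: ssvalP.
split; last by move=> i; rewrite inE; split=> /asboolP.
elim/last_ind => [|w e [Gr Lr]].
  by split; [have [] := rP 1 G1 | apply: rL].
have Gx : G (ssval e) by apply: Gs; apply: ssvalP.
have Grx : G (r (run d w) * ssval e) by apply: sgM.
rewrite word_rcons /run !foldl_rcons -!/(run d _) /= ffunE /=.
split; first by have [] := rP _ Grx.
rewrite (_ : _ / _ = (word w / r (run d w)) *
    (r (run d w) * ssval e / r (phi (r (run d w) * ssval e)))).
  by apply: sgM => //; apply: rL.
by rewrite !gnorm.
Qed.

Lemma automaton_lang (G L : set gT) :
  is_subgroup G -> is_subgroup L -> L `<=` G ->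
  (forall x, x \in s -> G x) -> (forall g, G g -> exists w : seq (seq_sub s), g = word w) ->
  labels G L n -> exists d : automaton, forall g, L g <-> lang d g.
Proof.
move=> sG sL sLG Gs Gw labL.
have [d [r [_ _ [rP dP]]]] := automatonP sG sL sLG Gs labL.
have key w : L (word w) <-> run d w \in d.2.
  have [_ Lw] := rP w; rewrite dP -[in X in X <-> _](mulgVK (r (run d w)) (word w)).
  exact: sgMl.
exists d => g; split=> [Lg|[w ->]]; last by move/key.
by have [w Eg] := Gw g (sLG g Lg); exists w => //; apply/key; rewrite -Eg.
Qed.

End Automaton.

(** Each transition i -e-> j of the coset automaton yields the Schreier generator
    r_i e / r_j; along a word for g in L they multiply to g, up to the initial
    representative and the last one, which lies in L. *)
Lemma Schreier (G L : set gT) : is_subgroup G -> is_subgroup L -> L `<=` G ->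
  fin_gen G -> fin_idx G L -> fin_gen L.
Proof.
move=> sG sL sLG /(fin_gen_word sG)[s [Gs Gw]] [n labL].
have [d [r [r1 rS [rP dP]]]] := automatonP sG sL sLG Gs labL.
pose S1 := [seq r ix.1 * ssval ix.2 / r (d.1.2 ix) | ix : 'I_n * seq_sub s].
pose S := (r d.1.1)^-1 :: [seq x <- S1 ++ [seq r i | i in 'I_n] | `[<L x>]].
have SP H : (forall x, x \in S -> H x) ->
    [/\ H (r d.1.1)^-1, forall i e, G (r i) -> H (r i * ssval e / r (d.1.2 (i, e)))
      & forall i, L (r i) -> H (r i)].
  move=> HS; split=> [|i e Gri|i Lri]; apply: HS; rewrite inE ?eqxx //.
    apply/orP; right; rewrite mem_filter mem_cat; apply/andP; split.
      by apply/asboolP; apply: rS.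
    by apply/orP; left; apply/fintype.imageP; exists (i, e).
  apply/orP; right; rewrite mem_filter mem_cat; apply/andP; split; first exact/asboolP.
  by apply/orP; right; apply/fintype.imageP; exists i.
exists S; split=> [x|H sH /SP[H1 HS Hr] g Lg].
  by rewrite inE => /orP[/eqP->|]; [exact: sgV | rewrite mem_filter => /andP[/asboolP]].
have [w Eg] := Gw g (sLG g Lg).
suff Hw : H (g / r (run d w)).
  rewrite -(mulgVK (r (run d w)) g); apply: sgM => //; apply: Hr.
  have [_ Lw] := rP w; have := Lg; rewrite -{1}(mulgVK (r (run d w)) g).
  by rewrite sgMl // Eg.
rewrite {}Eg {Lg}; elim/last_ind: w => [|w e IH]; first by rewrite mul1g.
have [Gr _] := rP w.
rewrite word_rcons /run !foldl_rcons -!/(run d _).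
rewrite (_ : _ / _ = (word w / r (run d w)) *
    (r (run d w) * ssval e / r (d.1.2 (run d w, e)))); last by rewrite !gnorm.
by apply: sgM => //; apply: HS.
Qed.

(** A finitely generated group has finitely many subgroups of bounded index,
    because each is the language of one of finitely many automata. *)
Lemma pigeonhole_subgroups (G : set gT) (Ls : nat -> set gT) n :
  is_subgroup G -> fin_gen G ->
  (forall i, is_subgroup (Ls i)) -> (forall i, Ls i `<=` G) ->
  (forall i, labels G (Ls i) n) -> exists i p, 0 < p /\ Ls (i + p) = Ls i.
Proof.
move=> sG /(fin_gen_word sG)[s [Gs Gw]] sLs sLG labL.
have /choice[d dP] : forall i, exists d : automaton s n, forall g, Ls i g <-> lang d g.
  by move=> i; apply: (automaton_lang sG).
pose N := #|{: automaton s n}|.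
have : ~~ injectiveb (fun i : 'I_N.+1 => d i).
  by apply/negP => /injectiveP /leq_card; rewrite !card_ord ltnn.
move=> /injectivePn[i [j neij Eij]].
wlog ltij : i j neij Eij / i < j.
  move=> IH; have /orP[ltij|ltji] : (i < j) || (j < i).
  - by rewrite -neq_ltn.
  - exact: (IH i j).
  - by apply: (IH j i) => //; rewrite eq_sym.
exists i, (j - i); split; first by rewrite subn_gt0.
by rewrite subnKC ?(ltnW ltij) //; apply/predeqP => g; rewrite !dP Eij.
Qed.

End GroupSets.

(** * Characters of abelian quotients *)

(** The quotient L / M is not formed: M is automatically normal in L, and
    M (u / v) is used as a congruence on L. *)
Record ab_quotient (gT : groupType) (L M : set gT) : Prop := AbQuotient {
  abL : is_subgroup L;
  abM : is_subgroup M;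
  abML : M `<=` L;
  abC : forall u v, L u -> L v -> M [~ u, v]
}.

Section AbQuotient.
Variable gT : groupType.
Implicit Types (G H K L M : set gT) (g h u v x y : gT).

Section Congruence.
Variables (L M : set gT).
Hypothesis (abLM : ab_quotient L M).
Let sL := abL abLM.
Let sM := abM abLM.

Lemma abJ u g : L g -> M u -> M (u ^ g).
Proof.
move=> Lg Mu; have -> : u ^ g = u * [~ u, g] by rewrite commgEl mulVKg.
by apply: sgM => //; apply: (abC abLM) => //; apply: (abML abLM).
Qed.

Lemma eqm_sym u v : M (u / v) -> M (v / u). Proof. exact: sgDC. Qed.

Lemma eqm_trans v u w : M (u / v) -> M (v / w) -> M (u / w).
Proof. by move=> uv vw; have := sgM sM uv vw; rewrite !gnorm. Qed.

Lemma eqmM u u' v v' : L u -> L u' -> L v -> L v' -> M (u / u') -> M (v / v') ->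
  M (u * v / (u' * v')).
Proof.
move=> Lu Lu' Lv Lv' uu vv.
have -> : u * v / (u' * v') = (v / v') ^ u^-1 * (u / u').
  by rewrite conjgE !gnorm.
by apply: sgM => //; apply: abJ => //; apply: sgV.
Qed.

Lemma eqmC u v : L u -> L v -> M (u * v / (v * u)).
Proof. by move=> Lu Lv; rewrite (commgCV u v) mulgK; apply: (abC abLM); apply: sgV. Qed.

Lemma eqmX u v n : L u -> L v -> M (u / v) -> M (u ^+ n / v ^+ n).
Proof.
move=> Lu Lv uv; elim: n => [|n IHn]; first by rewrite mulgV; apply: sg1.
by rewrite !expgS; apply: eqmM => //; apply: sgX.
Qed.

Lemma eqmMX u v n : L u -> L v -> M ((u * v) ^+ n / (u ^+ n * v ^+ n)).
Proof.
move=> Lu Lv; elim: n => [|n IHn]; first by rewrite !gnorm; apply: sg1.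
have LX x m : L x -> L (x ^+ m) by move=> Lx; apply: sgX.
have LM x y : L x -> L y -> L (x * y) by apply: sgM.
have uvn : L ((u * v) ^+ n) by apply/LX/LM.
apply: (@eqm_trans (u * v * (u ^+ n * v ^+ n))).
  by rewrite expgS; apply: eqmM; rewrite ?mulgV; auto; exact: sg1.
have -> : u * v * (u ^+ n * v ^+ n) = u * ((v * u ^+ n) * v ^+ n) by rewrite !mulgA.
have -> : u ^+ n.+1 * v ^+ n.+1 = u * ((u ^+ n * v) * v ^+ n) by rewrite !expgS !mulgA.
apply: eqmM; rewrite ?mulgV; auto; first exact: sg1.
by apply: eqmM; rewrite ?mulgV; auto; [apply: eqmC; auto | exact: sg1].
Qed.
End Congruence.

(** An integral character of the group L / K, as a function on the ambient group
    whose values outside L are arbitrary. *)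
Definition character (L K : set gT) (F : gT -> int) : Prop :=
  (forall u v, L u -> L v -> F (u * v) = (F u + F v)%R) /\
  (forall u, K u -> F u = 0%R).

(** If x has infinite order modulo M and the N-th power of every element of L is
    congruent to a power of x, then u |-> (the exponent of x in u^N) is a
    character. The exponent is written b - a to stay within natural powers. *)
Section RankOne.
Variables (L M : set gT) (x : gT) (N : nat).
Hypothesis (abLM : ab_quotient L M) (Lx : L x).
Hypothesis (xinf : forall k, 0 < k -> ~ M (x ^+ k)) (N_gt0 : 0 < N).
Hypothesis (LN : forall u, L u -> exists a b, M (u ^+ N * x ^+ a / x ^+ b)).
Let sL := abL abLM.
Let sM := abM abLM.

Lemma rank_one_unique u a b a' b' : L u ->
  M (u ^+ N * x ^+ a / x ^+ b) -> M (u ^+ N * x ^+ a' / x ^+ b') ->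
  (b%:Z - a%:Z = b'%:Z - a'%:Z)%R.
Proof.
move=> Lu Mab Mab'.
have LX y m : L y -> L (y ^+ m) by move=> Ly; apply: sgX.
have LM y z : L y -> L z -> L (y * z) by apply: sgM.
have e1 : M (u ^+ N * x ^+ (a + a') / x ^+ (b + a')).
  rewrite !expgnDr mulgA; apply: (eqmM abLM); rewrite ?mulgV; auto; exact: sg1.
have e2 : M (u ^+ N * x ^+ (a + a') / x ^+ (b' + a)).
  rewrite addnC !expgnDr mulgA; apply: (eqmM abLM); rewrite ?mulgV; auto; exact: sg1.
have e3 := eqm_trans abLM (eqm_sym abLM e1) e2.
have [lt|lt|] := ltngtP (b + a') (b' + a); last by lia.
  case: (@xinf (b' + a - (b + a'))); first by rewrite subn_gt0.
  by rewrite expgnFr ?(ltnW lt) //; apply: (eqm_sym abLM).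
case: (@xinf (b + a' - (b' + a))); first by rewrite subn_gt0.
by rewrite expgnFr ?(ltnW lt).
Qed.

Lemma rank_one_character : exists F, character L M F /\ exists2 u, L u & F u <> 0%R.
Proof.
have LX y m : L y -> L (y ^+ m) by move=> Ly; apply: sgX.
have LM y z : L y -> L z -> L (y * z) by apply: sgM.
have /choice[F FP] : forall u, exists z : int, L u ->
    exists a b, z = (b%:Z - a%:Z)%R /\ M (u ^+ N * x ^+ a / x ^+ b).
  move=> u; have [Lu|nLu] := pselect (L u); last by exists 0%R.
  by have [a [b Mab]] := LN Lu; exists (b%:Z - a%:Z)%R => _; exists a, b.
have FE u a b : L u -> M (u ^+ N * x ^+ a / x ^+ b) -> F u = (b%:Z - a%:Z)%R.
  move=> Lu Mab; have [a' [b' [-> Mab']]] := FP u Lu.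
  exact: rank_one_unique Mab' Mab.
exists F; split; [split|].
- move=> u v Lu Lv; have [a [b [-> Mu]]] := FP u Lu; have [c [d [-> Mv]]] := FP v Lv.
  rewrite (@FE _ (a + c) (b + d)); [by lia | by auto |].
  apply: (@eqm_trans _ _ abLM (u ^+ N * x ^+ a * (v ^+ N * x ^+ c))); last first.
    by rewrite expgnDr; apply: (eqmM abLM); auto.
  apply: (@eqm_trans _ _ abLM (u ^+ N * v ^+ N * x ^+ (a + c))).
    apply: (eqmM abLM); rewrite ?mulgV; auto; last exact: sg1.
    by apply: (eqmMX abLM).
  have -> : u ^+ N * x ^+ a * (v ^+ N * x ^+ c) = u ^+ N * ((x ^+ a * v ^+ N) * x ^+ c).
    by rewrite !mulgA.
  have -> : u ^+ N * v ^+ N * x ^+ (a + c) = u ^+ N * ((v ^+ N * x ^+ a) * x ^+ c).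
    by rewrite expgnDr !mulgA.
  apply: (eqmM abLM); rewrite ?mulgV; auto; first exact: sg1.
  apply: (eqmM abLM); rewrite ?mulgV; auto; [apply: (eqmC abLM); auto | exact: sg1].
- move=> u Mu; rewrite (@FE u 0 0) //; first exact: (abML abLM).
  by rewrite !gnorm; apply: sgX.
exists x => //; rewrite (@FE x 0 N) //; first by lia.
by rewrite expg0 mulg1 mulgV; exact: sg1.
Qed.
End RankOne.

(** The subgroup generated by K and x, when K contains the commutators of a group
    containing K and x. *)
Definition adjoin (K : set gT) (x : gT) : set gT :=
  [set u | exists a b, K (u * x ^+ a / x ^+ b)].

Lemma adjoin_ab L K x : ab_quotient L K -> L x ->
  [/\ K `<=` adjoin K x, adjoin K x x & ab_quotient L (adjoin K x)].
Proof.
move=> abLK Lx; have sL := abL abLK; have sK := abM abLK.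
have LX y m : L y -> L (y ^+ m) by move=> Ly; apply: sgX.
have LM y z : L y -> L z -> L (y * z) by apply: sgM.
have sKx : K `<=` adjoin K x by move=> u Ku; exists 0, 0; rewrite !gnorm.
have sxL : adjoin K x `<=` L.
  move=> u [a [b /(abML abLK)]]; rewrite -mulgA (sgMr _ sL) //.
  by apply: sgD => //; apply: LX.
split=> //; first by exists 0%N, 1%N; rewrite expg0 mulg1 mulgV; apply: sg1.
split=> //; last by move=> u v Lu Lv; apply/sKx/(abC abLK).
split; first by apply/sKx; exact: sg1.
  move=> u v Au Av; have [Lu Lv] := (sxL _ Au, sxL _ Av).
  have [[a [b Mu]] [c [d Mv]]] := (Au, Av).
  exists (a + c), (b + d).
  apply: (@eqm_trans _ _ abLK (u * x ^+ a * (v * x ^+ c))); last first.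
    by rewrite expgnDr; apply: (eqmM abLK); auto.
  have -> : u * x ^+ a * (v * x ^+ c) = u * ((x ^+ a * v) * x ^+ c).
    by rewrite !mulgA.
  have -> : u * v * x ^+ (a + c) = u * ((v * x ^+ a) * x ^+ c).
    by rewrite expgnDr !mulgA.
  apply: (eqmM abLK); rewrite ?mulgV; auto; first exact: sg1.
  apply: (eqmM abLK); rewrite ?mulgV; auto; [apply: (eqmC abLK); auto | exact: sg1].
move=> u Au; have Lu := sxL _ Au; have [a [b Mu]] := Au; exists b, a.
have := sgV sK Mu; rewrite !invgM invgK => Mu'.
have -> : u^-1 * x ^+ b / x ^+ a = (x ^+ b * (x ^- a * u^-1)) ^ (x ^+ b * x ^- a).
  by rewrite conjgE !gnorm.
by apply: (abJ abLK) => //; apply: sgD => //; apply: LX.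
Qed.

(** Adjoin the generators of L to K one at a time, and look at the last one, x,
    that has infinite order modulo the group M generated by K and its
    predecessors.
    Then L modulo M and x is finite. If there is no such x, L / K is finite. *)
Lemma fin_gen_rank_one (s : seq gT) : forall L K, ab_quotient L K ->
  (forall x, x \in s -> L x) ->
  (forall H, is_subgroup H -> K `<=` H -> (forall x, x \in s -> H x) -> L `<=` H) ->
  fin_idx L K \/ exists M x N, [/\ ab_quotient L M, K `<=` M, L x /\ 0 < N,
   (forall k, 0 < k -> ~ M (x ^+ k)) &
   forall u, L u -> exists a b, M (u ^+ N * x ^+ a / x ^+ b)].
Proof.
elim: s => [|x s IH] L K abLK Ls gen.
  left; exists 1%N; exists (fun=> ord0) => g h Lg Lh _.
  have sLK : L `<=` K by apply: gen => //; exact: abM abLK.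
  by apply: sLK; apply: sgD => //; exact: (abL abLK).
have sL := abL abLK; have sK := abM abLK.
have Lx : L x by apply: Ls; rewrite mem_head.
have [sKx Kxx abx] := adjoin_ab abLK Lx.
have [||finL|[M [y [N [abLM KM LyN yinf LN]]]]] := IH L (adjoin K x) abx.
- by move=> y sy; apply: Ls; rewrite inE sy orbT.
- move=> H sH KxH Hs; apply: gen => //; first exact: subset_trans KxH.
  by move=> y; rewrite inE => /orP[/eqP->|/Hs//]; apply: KxH.
- have [xinf|] := pselect (forall k, 0 < k -> ~ K (x ^+ k)).
    (* N! is a common multiple of the exponents k <= N given by the finite index *)
    have [N N_gt0 LN] := fin_idx_expg sL finL.
    right; exists K, x, N`!; split=> //; first by rewrite fact_gt0.
    move=> u Lu; have [k /andP[k_gt0 lekN] Kuk] := LN u Lu.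
    have /dvdnP[c ->] : k %| N`! by apply: dvdn_fact; rewrite k_gt0.
    suff [a [b]] : adjoin K x (u ^+ (c * k)) by exists a, b.
    by rewrite mulnC expgnA; apply: sgX => //; apply: abM abx.
  move=> /existsNP[k /not_implyP[k_gt0 /contrapT Kxk]]; left.
  apply: fin_idx_trans finL _.
  exists k.
  have /choice[phi phiP] : forall u, exists i : 'I_k, adjoin K x u -> K (u / x ^+ i).
    move=> u; have [|nu] := pselect (adjoin K x u); last by exists (Ordinal k_gt0).
    move=> [a [b Kab]].
    (* modulo x^k, x^b / x^a is the power b + a (k - 1) *)
    have lt_ : (b + a * k.-1) %% k < k by rewrite ltn_mod.
    exists (Ordinal lt_) => _ /=; set c := b + a * k.-1.
    have LX m : L (x ^+ m) by apply: sgX.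
    have Kk m : K (x ^+ (m * k)) by rewrite mulnC expgnA; apply: sgX.
    have -> : u / x ^+ (c %% k) =
        (u * x ^+ a / x ^+ b) * (x ^+ b * x ^- a / x ^+ (c %% k)) by rewrite !gnorm.
    apply: (sgM sK) => //.
    have -> : x ^+ b * x ^- a / x ^+ (c %% k) = x ^+ (c %/ k * k) / x ^+ (a * k).
      apply: (@mulIg _ (x ^+ (c %% k + (a + a * k)))).
      rewrite [in LHS](expgnDr x (c %% k)) (expgnDr x a) !mulgA !mulgVK.
      rewrite (_ : c %% k + (a + a * k) = a * k + (c %% k + a))%N; last by lia.
      rewrite (expgnDr x (a * k)) mulgA mulgVK -!expgnDr addnA -divn_eq.
      by congr (_ ^+ _); rewrite /c; nia.
    by apply: sgD.
  exists phi => g h Ag Ah E.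
  have := sgD sK (phiP g Ag) (phiP h Ah); rewrite E.
  by rewrite !gnorm.
right; exists M, y, N; split=> //.
by apply: subset_trans KM.
Qed.

Lemma exists_character L K : ab_quotient L K -> fin_gen L -> ~ fin_idx L K ->
  exists F, character L K F /\ exists2 u, L u & F u <> 0%R.
Proof.
move=> abLK [s [Ls gens]] ninf.
have [|//|[M [x [N [abLM KM [Lx N_gt0] xinf LN]]]]] := fin_gen_rank_one abLK Ls.
  by move=> H sH _ Hs; apply: gens.
have [F [[FM F0] Fn]] := rank_one_character abLM Lx xinf N_gt0 LN.
by exists F; split=> //; split=> // u /KM/F0.
Qed.

Lemma character_one L K F : is_subgroup L -> character L K F -> F 1 = 0%R.
Proof. by move=> sL [FM _]; have := FM 1 1 (sg1 sL) (sg1 sL); rewrite mulg1; lia. Qed.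

Lemma characterV L K F u : is_subgroup L -> character L K F -> L u -> F u^-1 = (- F u)%R.
Proof.
move=> sL chF Lu.
by have := chF.1 _ _ Lu (sgV sL Lu); rewrite mulgV (character_one sL chF); lia.
Qed.

Lemma character_eq L K F u v : is_subgroup L -> character L K F -> L u -> L v -> K (u / v) ->
  F u = F v.
Proof.
move=> sL chF Lu Lv /chF.2; rewrite chF.1 ?(characterV sL chF) //; first by lia.
exact: sgV.
Qed.

Lemma characterX L K F u n : is_subgroup L -> character L K F -> L u ->
  F (u ^+ n) = (F u *+ n)%R.
Proof.
move=> sL chF Lu; elim: n => [|n IH].
  by rewrite expg0 (character_one sL chF) GRing.mulr0n.
by rewrite expgS chF.1 ?IH ?GRing.mulrS //; apply: sgX.
Qed.

Lemma character_neq0_gen (s : seq gT) L K F :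
  is_subgroup L -> character L K F -> generated_by s L ->
  (exists2 u, L u & F u <> 0%R) -> exists2 u, u \in s & F u <> 0%R.
Proof.
move=> sL chF [Ls gen] [u Lu Fu]; apply: contrapT => noS; apply: Fu.
suff [] : [set v | L v /\ F v = 0%R] u by [].
apply: gen Lu.
  split; first by split; [exact: sg1 | exact: (character_one sL chF)].
    by move=> x y [Lx Fx] [Ly Fy]; split; [exact: sgM | rewrite chF.1 // Fx Fy].
  by move=> x [Lx Fx]; split; [exact: sgV | rewrite (characterV sL chF) // Fx].
move=> x sx; split; first exact: Ls.
by apply: contrapT => Fx; apply: noS; exists x.
Qed.

End AbQuotient.

(** * Sections of tree automorphisms *)

Section SubgroupPred.
Variables (gT : groupType) (H : set gT).

Definition subgroup_pred (sH : is_subgroup H) : {pred gT} := fun x => `[<H x>].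

Variable sH : is_subgroup H.

Lemma subgroup_predP x : x \in subgroup_pred sH <-> H x.
Proof. by rewrite unfold_in /subgroup_pred asboolE. Qed.

Fact subgroup_pred1 : 1 \in subgroup_pred sH.
Proof. by apply/subgroup_predP; exact: sg1. Qed.
Fact subgroup_predM : mulg_closed (subgroup_pred sH).
Proof.
by move=> x y /subgroup_predP Hx /subgroup_predP Hy; apply/subgroup_predP; exact: sgM.
Qed.
Fact subgroup_predV : invg_closed (subgroup_pred sH).
Proof. by move=> x /subgroup_predP Hx; apply/subgroup_predP; exact: sgV. Qed.

Definition subgroup_closed : groupClosed gT :=
  HB.pack (subgroup_pred sH)
    (isInvClosed.Build gT (subgroup_pred sH) subgroup_predV)
    (isMul1Closed.Build gT (subgroup_pred sH) subgroup_pred1)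
    (isMulClosed.Build gT (subgroup_pred sH) subgroup_predM).

Lemma subgroup_closedP x : x \in subgroup_closed <-> H x.
Proof. exact: subgroup_predP. Qed.
End SubgroupPred.

Section Morphisms.
Variables (aT rT : groupType) (f : aT -> rT).
Hypothesis fM : {morph f : x y / x * y}.

Lemma morph_one : f 1 = 1.
Proof. by apply: (@mulgI _ (f 1)); rewrite -fM !mulg1. Qed.

Lemma morph_inv : {morph f : x / x^-1}.
Proof. by move=> x; apply: (@mulgI _ (f x)); rewrite -fM !mulgV morph_one. Qed.
End Morphisms.

Section Sections.
Variable X : finType.
Implicit Types (g h u v t : tree_aut X) (x y z : X).

Definition sec g x : tree_aut X := section g [:: x].

Lemma tree_aut_cons g x (w : seq X) : g (x :: w) = pi1 g x :: sec g x w.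
Proof. by rewrite -cat1s sectionE pi1E. Qed.

Lemma sec_pi1M g h x : sec (g * h) x = sec g x * sec h (pi1 g x).
Proof.
apply: tree_aut_ext => w; have : (g * h) (x :: w) = h (g (x :: w)) by [].
by rewrite !tree_aut_cons => -[_ E]; exact: E.
Qed.

Lemma sec_one x : sec 1 x = 1.
Proof.
apply: tree_aut_ext => w; have : (1 : tree_aut X) (x :: w) = x :: w by [].
by rewrite tree_aut_cons => -[_ E]; exact: E.
Qed.

Lemma pi1_one : pi1 (1 : tree_aut X) = 1. Proof. exact: morph_one (@pi1M X). Qed.
Lemma pi1V g : pi1 g^-1 = (pi1 g)^-1. Proof. exact: morph_inv (@pi1M X) g. Qed.
Lemma rooted1 : rooted (1 : {perm X}) = 1. Proof. exact: morph_one (@rootedM X). Qed.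
Lemma pi1X g n : pi1 (g ^+ n) = pi1 g ^+ n.
Proof. by elim: n => [|n IHn]; rewrite ?expg0 ?pi1_one // !expgS pi1M IHn. Qed.

Lemma sec_pi1V g x : sec g^-1 x = (sec g (pi1 g^-1 x))^-1.
Proof.
apply: (@mulIg _ (sec g (pi1 g^-1 x))).
by rewrite -sec_pi1M !mulVg sec_one.
Qed.

Lemma sec_rooted (s : {perm X}) x : sec (rooted s) x = 1.
Proof.
apply: tree_aut_ext => w; have : rooted s (x :: w) = s x :: w by [].
by rewrite tree_aut_cons => -[_ E]; exact: E.
Qed.

Lemma sec_stabM g h x : pi1 g = 1 -> sec (g * h) x = sec g x * sec h x.
Proof. by move=> g1; rewrite sec_pi1M g1 perm1. Qed.

Lemma sec_stabV g x : pi1 g = 1 -> sec g^-1 x = (sec g x)^-1.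
Proof. by move=> g1; rewrite sec_pi1V pi1V g1 invg1 perm1. Qed.

Lemma sec_stabX g x n : pi1 g = 1 -> sec (g ^+ n) x = sec g x ^+ n.
Proof.
move=> g1; elim: n => [|n IHn]; first by rewrite !expg0 sec_one.
by rewrite !expgS sec_stabM ?IHn.
Qed.

Lemma sec_stabJ u g y : pi1 u = 1 -> sec (u ^ g) (pi1 g y) = (sec u y) ^ (sec g y).
Proof.
move=> u1; rewrite !conjgE sec_pi1M sec_pi1V pi1V permK sec_pi1M u1 perm1.
by [].
Qed.

Lemma pi1J u g : pi1 u = 1 -> pi1 (u ^ g) = 1.
Proof. by move=> u1; rewrite !conjgE !pi1M u1 mul1g pi1V mulVg. Qed.

Lemma rooted_pi1 g : (forall x, sec g x = 1) -> g = rooted (pi1 g).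
Proof.
by move=> g1; apply: tree_aut_ext => -[|x w]; rewrite ?tree_aut_nil // tree_aut_cons g1.
Qed.
End Sections.

(** * The section operator on subgroups of a self-replicating group *)

Section SelfReplicating.
Variables (X : finType) (G : set (tree_aut X)) (x0 : X).
Implicit Types (g h u v t : tree_aut X) (H K L : set (tree_aut X)).

Hypothesis sG : is_subgroup G.
Hypothesis Gsec : forall g x, G g -> G (sec g x).
Hypothesis Gtrans : forall x y, exists2 g, G g & pi1 g x = y.
Hypothesis Glift : forall x h, G h -> exists g, [/\ G g, pi1 g x = x & sec g x = h].
Hypothesis Gab : forall g h, G g -> G h -> commute (pi1 g) (pi1 h).

(** A transitive abelian permutation group acts freely. *)
Lemma pi1_regular g x : G g -> pi1 g x = x -> pi1 g = 1.
Proof.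
move=> Gg gx; apply/permP => y; have [h Gh <-] := Gtrans x y.
by rewrite -permM (Gab Gh Gg) permM gx perm1.
Qed.

Definition sigma H : set (tree_aut X) :=
  [set h | exists u, [/\ H u, pi1 u = 1 & sec u x0 = h]].

Lemma sigma_mono H K : H `<=` K -> sigma H `<=` sigma K.
Proof. by move=> sHK _ [u [Hu u1 <-]]; exists u; split=> //; apply: sHK. Qed.

Lemma sigma_subgroup H : is_subgroup H -> is_subgroup (sigma H).
Proof.
move=> sH; split.
- by exists 1; split; [exact: sg1 | exact: pi1_one | exact: sec_one].
- move=> _ _ [u [Hu u1 <-]] [v [Hv v1 <-]]; exists (u * v).
  by split; [exact: sgM | rewrite pi1M u1 v1 mulg1 | rewrite sec_stabM].
move=> _ [u [Hu u1 <-]]; exists u^-1.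
by split; [exact: sgV | rewrite pi1V u1 invg1 | rewrite sec_stabV].
Qed.

Lemma sigmaG g : G g -> exists2 u, G u & pi1 u = 1 /\ sec u x0 = g.
Proof.
by move=> Gg; have [u [Gu ux <-]] := Glift x0 Gg; exists u => //; rewrite (pi1_regular Gu ux).
Qed.

(** Self-replication lifts a conjugating element of G to one that fixes x0. *)
Lemma sigma_normal H : normal_in G H -> normal_in G (sigma H).
Proof.
move=> [sH HG HJ]; split; first exact: sigma_subgroup.
  by move=> _ [u [Hu _ <-]]; apply/Gsec/HG.
move=> _ g [u [Hu u1 <-]] Gg; have [v Gv [v1 <-]] := sigmaG Gg.
exists (u ^ v); split; [exact: HJ | exact: pi1J |].
by rewrite -[in LHS](perm1 x0) -v1 sec_stabJ.
Qed.

(** Conjugating by an element of G that moves y to x0 turns sections at y into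
    sections at x0; this is why sigma does not depend on the letter. *)
Lemma sigma_sec H u y : normal_in G H -> H u -> pi1 u = 1 -> sigma H (sec u y).
Proof.
move=> nH Hu u1; have [sH HG HJ] := nH.
have [g Gg gy] := Gtrans y x0; have [_ _ sJ] := sigma_normal nH.
have -> : sec u y = (sec (u ^ g) x0) ^ (sec g y)^-1.
  by rewrite -gy sec_stabJ // conjgK.
apply: sJ; last by apply/(sgV sG)/Gsec.
by exists (u ^ g); split; [exact: HJ | exact: pi1J | ].
Qed.

Lemma sigma_ab L K : ab_quotient L K -> ab_quotient (sigma L) (sigma K).
Proof.
move=> [sL sK KL LC]; split; try exact: sigma_subgroup; first exact: sigma_mono.
move=> _ _ [u [Lu u1 <-]] [v [Lv v1 <-]]; exists [~ u, v]; split; first exact: LC.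
  by rewrite commgEl conjgE !pi1M !pi1V u1 v1 !gnorm.
rewrite !commgEl !conjgE !sec_stabM ?sec_stabV //; try by rewrite pi1V ?u1 ?v1 invg1.
Qed.

Lemma sigma_labels H n : labels G H n -> labels G (sigma H) n.
Proof.
move=> [phi phiP].
have /choice[lift liftP] : forall g, exists u, G g -> [/\ G u, pi1 u = 1 & sec u x0 = g].
  move=> g; have [Gg|nG] := pselect (G g); last by exists 1.
  by have [u Gu [u1 ux]] := sigmaG Gg; exists u.
exists (phi \o lift) => g h Gg Gh E.
have [[Gu u1 ux] [Gv v1 vx]] := (liftP g Gg, liftP h Gh).
exists (lift g / lift h); split; first exact: phiP.
  by rewrite pi1M pi1V u1 v1 invg1 mulg1.
by rewrite sec_stabM // sec_stabV // ux vx.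
Qed.

Definition letter_trans L := forall x y, exists2 l, L l & pi1 l x = y.

(** Some coset of H avoids the stabiliser of the letters, so its label is not
    needed for sigma H. *)
Lemma sigma_labels_lt H n : is_subgroup H -> H `<=` G ->
  labels G H n.+1 -> ~ letter_trans H -> labels G (sigma H) n.
Proof.
move=> sH HG [phi phiP] ntr.
have [h Gh hP] : exists2 h, G h & forall l, H l -> pi1 l <> pi1 h.
  apply: contrapT => noh; apply: ntr => x y; have [h Gh hx] := Gtrans x y.
  apply: contrapT => nol; apply: noh; exists h => // l Hl E; apply: nol.
  by exists l; rewrite // E.
have phiSt u : G u -> pi1 u = 1 -> phi u != phi h.
  move=> Gu u1; apply/eqP => E; have := phiP _ _ Gh Gu (esym E).
  by move/hP; rewrite pi1M pi1V u1 invg1 mulg1.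
have /choice[lift liftP] : forall g, exists u, G g -> [/\ G u, pi1 u = 1 & sec u x0 = g].
  move=> g; have [Gg|nG] := pselect (G g); last by exists 1.
  by have [u Gu [u1 ux]] := sigmaG Gg; exists u.
have n_gt0 : 0 < n.
  rewrite lt0n; apply/eqP => n0; case/eqP: (phiSt _ (sg1 sG) (pi1_one _)).
  by apply: val_inj => /=; have := ltn_ord (phi 1); have := ltn_ord (phi h); lia.
pose phi' g := odflt (Ordinal n_gt0) (unlift (phi h) (phi (lift g))).
exists phi' => g k Gg Gk; have [[Gu u1 ux] [Gv v1 vx]] := (liftP g Gg, liftP k Gk).
rewrite /phi'; have := phiSt _ Gu u1; have := phiSt _ Gv v1.
rewrite eq_sym => /unlift_some[j Ej ->]; rewrite eq_sym => /unlift_some[i Ei ->] /= Eij.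
exists (lift g / lift k); split; first by apply: phiP; rewrite // Ei Ej Eij.
  by rewrite pi1M pi1V u1 v1 invg1 mulg1.
by rewrite sec_stabM // sec_stabV // ux vx.
Qed.

(** * Directed length *)

Definition rooted_in g := G g /\ forall x, sec g x = 1.

Definition directed_in t :=
  G t /\ exists2 x, sec t x = t & forall z, z != x -> rooted_in (sec t z).

Lemma directedV t : directed_in t -> directed_in t^-1.
Proof.
move=> [Gt [x tx tz]]; split; first exact: sgV.
exists (pi1 t x); first by rewrite sec_pi1V pi1V permK tx.
move=> z zx; have [|Gs s1] := tz (pi1 t^-1 z).
  by apply: contraNneq zx => <-; rewrite pi1V permKV.
rewrite sec_pi1V; split; first exact: sgV.
by move=> y; rewrite sec_pi1V s1 invg1.
Qed.

Variable D : seq (tree_aut X).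
Hypothesis DP : forall t, t \in D -> directed_in t.
Hypothesis DV : forall t, t \in D -> t^-1 \in D.

(** Products of rooted elements and n elements of D. Rooted elements are not
    counted: their sections are trivial, and there are finitely many of them. *)
Inductive directed_len : nat -> tree_aut X -> Prop :=
| dl1 : directed_len 0 1
| dlR n g r : directed_len n g -> rooted_in r -> directed_len n (g * r)
| dlD n g t : directed_len n g -> t \in D -> directed_len n.+1 (g * t).

Lemma directed_len_mul m n g h :
  directed_len m g -> directed_len n h -> directed_len (n + m) (g * h).
Proof.
move=> dg dh; elim: n h / dh => [|n h r _ IH Rr|n h y _ IH Dy].
- by rewrite mulg1.
- by rewrite mulgA; apply: dlR.
by rewrite mulgA; apply: dlD.
Qed.

Lemma directed_lenX n g e : directed_len n g -> directed_len (e * n) (g ^+ e).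
Proof.
move=> dg; elim: e => [|e IH]; first by rewrite expg0; apply: dl1.
by rewrite expgSr mulSn; apply: directed_len_mul.
Qed.

Lemma directed_len_inv n g : directed_len n g -> directed_len n g^-1.
Proof.
move=> dg; elim: n g / dg => [|n g r _ IH [Gr r1]|n g y _ IH Dy].
- by rewrite invg1; apply: dl1.
- rewrite invgM -(addn0 n) -[r^-1]mul1g; apply: directed_len_mul => //; apply: dlR; first exact: dl1.
  by split; [exact: sgV | move=> x; rewrite sec_pi1V r1 invg1].
rewrite invgM -(addn1 n) -[y^-1]mul1g; apply: directed_len_mul => //; apply: dlD; first exact: dl1.
exact: DV.
Qed.

(** A letter t of D has a single section that is not rooted, namely t at its
    spine vertex z, so it contributes to exactly one of the sections of g. *)
Lemma directed_len_sec n g : directed_len n g -> exists2 k : X -> nat,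
  (\sum_x k x <= n)%N & forall x, directed_len (k x) (sec g x).
Proof.
move=> dg; elim: n g / dg => [|n g r _ [k lek dk] [Gr r1]|n g y _ [k lek dk] Dy].
- exists (fun=> 0%N); first by rewrite big1.
  by move=> x; rewrite sec_one; apply: dl1.
- by exists k => // x; rewrite sec_pi1M r1 mulg1.
have [Gy [z yz yR]] := DP Dy.
exists (fun x => (pi1 g x == z) + k x)%N.
  rewrite big_split /= -add1n; apply: leq_add lek.
  rewrite (reindex_inj (@perm_inj _ (pi1 g)^-1)) /=.
  under eq_bigr do rewrite permKV.
  by rewrite (bigD1 z) //= eqxx big1 // => x /negbTE->.
move=> x; rewrite sec_pi1M; have [->|neq] := eqVneq (pi1 g x) z.
  by rewrite yz add1n; apply: dlD.
by rewrite add0n; apply: dlR => //; apply: yR.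
Qed.

Lemma finite_bound (I : finType) (f : I -> nat) : exists C, forall i, f i <= C.
Proof. by exists (\max_i f i) => i; apply: leq_bigmax. Qed.

Lemma absz_add_le (a b : int) : (`|(a + b)%R| <= `|a| + `|b|)%N.
Proof. lia. Qed.

(** Rewrite a word for u through representatives r of the cosets of L, as in the
    proof of Schreier's lemma, keeping the current block of rooted letters aside:
    only the directed letters produce a factor, and these factors form a finite
    set on which F is bounded by C. *)
Lemma additive_bound L n (F : tree_aut X -> int) : is_subgroup L ->
  labels G L n -> (forall u v, L u -> L v -> F (u * v) = (F u + F v)%R) ->
  exists C B, forall m u, directed_len m u -> L u -> (`|F u| <= C * m + B)%N.
Proof.
move=> sL [phi phiP] FM; have [r rP] := label_repr phi G.
pose l i (s : {perm X}) t := r i * rooted s * t / r (phi (r i * rooted s * t)).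
have [C CP] := @finite_bound ('I_n * {perm X} * seq_sub D)%type
  (fun p => `|F (l p.1.1 p.1.2 (ssval p.2))|%N).
have [B BP] := @finite_bound ('I_n * {perm X})%type (fun p => `|F (r p.1 * rooted p.2)%g|%N).
pose B0 := `|F (1 / r (phi 1))%g|%N; exists C, (B0 + B).
have rL g : G g -> L (g / r (phi g)).
  by move=> Gg; have [Gr Er] := rP g Gg; apply: phiP.
have key m u : directed_len m u -> exists i s,
    [/\ G (r i), G (rooted s), L (u / rooted s / r i)
      & (`|F (u / rooted s / r i)%g| <= C * m + B0)%N].
  move=> du; elim: m u / du => [|m u ρ du IH [Gr r1]|m u y du IH Dy].
  - exists (phi 1), 1; rewrite rooted1 divg1; split; last by rewrite muln0.
    + by have [] := rP 1 (sg1 sG).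
    + exact: sg1.
    + by apply: rL; exact: sg1.
  - have [i [s [Gi Gs Lu Fu]]] := IH; exists i, (s * pi1 ρ).
    rewrite rootedM -(rooted_pi1 r1); split=> //; first exact: sgM.
      by rewrite invgM !mulgA mulgK.
    by rewrite invgM !mulgA mulgK.
  have [i [s [Gi Gs Lu Fu]]] := IH; have [Gy _] := DP Dy.
  have Gl : G (r i * rooted s * y) by do ?apply: sgM.
  exists (phi (r i * rooted s * y)), 1; rewrite rooted1 divg1.
  have E : u * y / r (phi (r i * rooted s * y)) = (u / rooted s / r i) * l i s y.
    by rewrite /l !gnorm.
  split; [by have [] := rP _ Gl | exact: sg1 | by rewrite E; apply: sgM => //; exact: rL |].
  rewrite E FM //; last exact: rL.
  have := CP (i, s, SeqSub Dy) => /=; rewrite mulnS => CP1.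
  apply: leq_trans (absz_add_le _ _) _.
  by rewrite addnC -addnA; apply: leq_add.
move=> m u du Lu; have [i [s [Gi Gs Lus Fu]]] := key m u du.
have Lrs : L (r i * rooted s).
  rewrite -(sgMl _ sL Lus) !gnorm //.
have -> : u = (u / rooted s / r i) * (r i * rooted s) by rewrite !gnorm.
rewrite FM // addnA; apply: leq_trans (absz_add_le _ _) _.
by apply: leq_add => //; apply: (BP (i, s)).
Qed.

(** The bound is required of all G-conjugates of F at once, as sections of a
    conjugate are conjugates of sections by elements of G that need not lie in
    the domain of F. It is written W |F| <= C m + B to avoid fractions. *)
Definition bounded W C B L (F : tree_aut X -> int) :=
  forall m u h, directed_len m u -> L u -> G h -> (W * `|F (u ^ h)%g| <= C * m + B)%N.

Lemma character_bound L K F : normal_in G L -> normal_in G K -> ab_quotient L K ->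
  fin_idx G L -> character L K F -> exists C B, bounded 1 C B L F.
Proof.
move=> [sL LG LJ] [sK KG KJ] abLK [n labL] chF.
have [phi phiP] := labL; have [r rP] := label_repr phi G.
have /choice[CB CBP] : forall i, exists CB : nat * nat,
    G (r i) -> forall m u, directed_len m u -> L u -> (`|F (u ^ r i)%g| <= CB.1 * m + CB.2)%N.
  move=> i; have [Gi|nG] := pselect (G (r i)); last by exists (0, 0)%N.
  have [|C [B CBP]] := @additive_bound L n (fun u => F (u ^ r i)) sL labL.
    by move=> u v Lu Lv; rewrite conjMg chF.1 //; apply: LJ.
  by exists (C, B).
have [C CP] := finite_bound (fun i => (CB i).1).
have [B BP] := finite_bound (fun i => (CB i).2).
exists C, B => m u h du Lu Gh; rewrite mul1n.
have [Gr Er] := rP h Gh; set i := phi h in Gr Er.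
have Ll : L (h / r i) by apply: phiP.
(* L acts trivially on L / K, so only the coset of h matters *)
have -> : F (u ^ h) = F (u ^ r i).
  apply: (character_eq sL chF); try exact: LJ.
  have -> : u ^ h = (u ^ (h / r i)) ^ r i by rewrite -conjgM mulgVK.
  rewrite -conjVg -conjMg; apply: (KJ) => //.
  have -> : u ^ (h / r i) / u = [~ u, h / r i] ^ u^-1.
    by rewrite commgEl !conjgE !gnorm.
  by apply: KJ; [apply: (abC abLK) | apply/(sgV sG)/LG].
apply: leq_trans (CBP i Gr m u du Lu) _.
by apply: leq_add; rewrite ?leq_mul2r ?CP ?BP ?orbT.
Qed.

(** * Pulling characters back along sections *)

(** The set underlying pi1 H, for which [group_set] is available when H is a
    subgroup. *)
Definition letter_image H : {set {perm X}} := [set s | `[<exists2 g, H g & pi1 g = s>]]%SET.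

Lemma mem_letter_image H s : (s \in letter_image H) <-> exists2 g, H g & pi1 g = s.
Proof. by rewrite inE; split=> /asboolP. Qed.

Lemma letter_image_group_set H : is_subgroup H -> group_set (letter_image H).
Proof.
move=> sH; apply/group_setP; split.
  by apply/mem_letter_image; exists 1; [exact: sg1 | exact: pi1_one].
move=> _ _ /mem_letter_image[g Hg <-] /mem_letter_image[h Hh <-]; apply/mem_letter_image.
by exists (g * h); [exact: sgM | exact: pi1M].
Qed.

(** Freeness makes s |-> s x0 injective on pi1 G. *)
Lemma card_letter_image_le : #|letter_image G| <= #|X|.
Proof.
rewrite -(@card_in_imset _ _ (fun s : {perm X} => s x0)) ?max_card //.
move=> _ _ /mem_letter_image[g Gg <-] /mem_letter_image[h Gh <-] E.
apply/eqP; rewrite eq_mulgV1 -pi1V -pi1M; apply/eqP.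
apply: (@pi1_regular _ x0); first exact: sgD.
by rewrite pi1M pi1V permM E permK.
Qed.

Section PullBack.
Variables L K : set (tree_aut X).
Hypotheses (nL : normal_in G L) (nK : normal_in G K) (abLK : ab_quotient L K).
Hypothesis trL : letter_trans L.
Let sL := abL abLK.
Let sK := abM abLK.

Let A := Group (letter_image_group_set sG).
Let B := Group (letter_image_group_set sK).
Let c := #|A : B|.
Let m := #|letter_image K|.

Let subBA : B \subset A.
Proof.
have [_ KG _] := nK.
by apply/fintype.subsetP => s /mem_letter_image[g /KG Gg <-]; apply/mem_letter_image; exists g.
Qed.

Let cm_A : (c * m)%N = #|A|.
Proof. by rewrite mulnC; exact: Lagrange subBA. Qed.

Let c_gt0 : 0 < c. Proof. exact: indexg_gt0. Qed.

Let pi1_expA u : G u -> pi1 (u ^+ (c * m)) = 1.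
Proof.
move=> Gu; rewrite cm_A pi1X; apply: expg_cardG.
by apply/mem_letter_image; exists u.
Qed.

Let pi1_expB u : G u -> exists2 k, K k & pi1 k = pi1 u ^+ c.
Proof.
move=> Gu; have Au : pi1 u \in A by apply/mem_letter_image; exists u.
have abA : abelian A.
  apply/centsP => _ /mem_letter_image[g Gg <-] _ /mem_letter_image[h Gh <-]; exact: Gab.
have nBA : B <| A by rewrite -(sub_abelian_normal _ abA).
apply/mem_letter_image.
have NB : pi1 u \in 'N(B) by apply: (fintype.subsetP (normal_norm nBA)).
suff : pi1 u ^+ c \in B by [].
apply: coset_idr; first by rewrite groupX.
by rewrite morphX // /c -card_quotient ?normal_norm // expg_cardG // mem_quotient.
Qed.

(** v is a representative of u^c modulo K that fixes every letter. *)
Let pull_witness u v := [/\ L v, pi1 v = 1 & K (v / u ^+ c)].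

Let pull_witness_exists u : L u -> exists v, pull_witness u v.
Proof.
move=> Lu; have Gu : G u by case: nL => _ LG _; apply: LG.
have [k Kk Ek] := pi1_expB Gu; have Luc := sgX c sL Lu.
exists (k^-1 * u ^+ c); split.
- by apply: sgM => //; apply: sgV => //; apply: (abML abLK).
- by rewrite pi1M pi1V Ek pi1X mulVg.
by rewrite mulgK; apply: sgV.
Qed.

(** With z = u^(c m), the value of F at the section of z^h at x0 is m F' (u^h).
    As L is transitive on letters and acts trivially on L / K, this is also, for
    each letter y, the value of a conjugate of F at the section of z at y. The
    bounds at the |X| letters add up to C c m n + |X| b, and c m = |pi1 G| <= |X|,
    so dividing by |X| leaves C n + b. *)
Lemma pull W C b F : character (sigma L) (sigma K) F ->
  (exists2 u, sigma L u & F u <> 0%R) -> bounded W C b (sigma L) F ->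
  exists F', [/\ character L K F', exists2 u, L u & F' u <> 0%R & bounded (W * m) C b L F'].
Proof.
move=> chF [h0 [u0 [Lu0 u01 Eu0]] Fh0] bF.
have ssL : is_subgroup (sigma L) by exact: sigma_subgroup.
have [_ LG LJ] := nL; have [_ KG KJ] := nK.
have Fst v v' : L v -> L v' -> pi1 v = 1 -> pi1 v' = 1 -> K (v / v') ->
    F (sec v x0) = F (sec v' x0).
  move=> Lv Lv' v1 v1' Kvv; apply: (character_eq ssL chF); [by exists v | by exists v' |].
  exists (v / v'); split=> //; first by rewrite pi1M pi1V v1 v1' invg1 mulg1.
  by rewrite sec_stabM // sec_stabV.
have /choice[w wP] : forall u, exists v, L u -> pull_witness u v.
  move=> u; have [Lu|nLu] := pselect (L u); last by exists 1.
  by have [v vP] := pull_witness_exists Lu; exists v.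
have FE u v : L u -> pull_witness u v -> F (sec (w u) x0) = F (sec v x0).
  move=> Lu [Lv v1 Kv]; have [Lw w1 Kw] := wP u Lu; apply: Fst => //.
  exact: (eqm_trans abLK Kw (eqm_sym abLK Kv)).
exists (fun u => F (sec (w u) x0)); split; first split.
- move=> u v Lu Lv; have [Lwu wu1 Kwu] := wP u Lu; have [Lwv wv1 Kwv] := wP v Lv.
  rewrite (@FE _ (w u * w v)); first 1 last; first exact: sgM.
    split; [exact: sgM | by rewrite pi1M wu1 wv1 mulg1 |].
    apply: (eqm_trans abLK (v := u ^+ c * v ^+ c)).
      by apply: (eqmM abLK) => //; apply: sgX.
    by apply: (eqm_sym abLK); apply: (eqmMX abLK).
  by rewrite sec_stabM // chF.1 //; [exists (w u) | exists (w v)].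
- move=> u Ku; rewrite (@FE _ 1); first 1 last; first exact: (abML abLK).
    split; [exact: sg1 | exact: pi1_one |].
    by rewrite mul1g; apply: sgV => //; apply: sgX.
  by rewrite sec_one (character_one ssL chF).
- exists u0 => //; rewrite (@FE _ (u0 ^+ c)) //; last first.
    by split; [exact: sgX | rewrite pi1X u01 expg1n | rewrite mulgV; exact: sg1].
  rewrite sec_stabX // (characterX _ ssL chF) ?Eu0; last by exists u0.
  by rewrite -GRing.mulr_natr natz; move: c_gt0 Fh0; clearbody c; nia.
move=> n u h du Lu Gh; set f := F _.
have Luh : L (u ^ h) by apply: LJ.
have [Lw w1 Kw] := wP _ Luh.
pose z : tree_aut X := u ^+ (c * m); have Lz : L z by apply: sgX.
have z1 : pi1 z = 1 by apply/pi1_expA/LG.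
have zh1 : pi1 (z ^ h) = 1 by apply: pi1J.
have Lzh : L (z ^ h) by apply: LJ.
have Ezh : F (sec (z ^ h) x0) = (f *+ m)%R.
  rewrite /f -(characterX _ ssL chF); last by exists (w (u ^ h)).
  rewrite -sec_stabX //; apply: Fst => //; first exact: sgX.
    by rewrite pi1X w1 expg1n.
  rewrite /z conjXg expgnA; apply: (eqmX abLK) => //; first by apply: sgX.
  exact: (eqm_sym abLK).
have [k lek dk] := directed_len_sec (directed_lenX (c * m) du).
have bk y : (W * m * `|f| <= C * k y + b)%N.
  have [l Ll Ely] := trL (pi1 h y) x0; have Gl := LG _ Ll.
  have Ghl : G (h * l) by apply: sgM.
  have Ehl : pi1 (h * l) y = x0 by rewrite pi1M permM.
  have Ez : F (sec (z ^ (h * l)) x0) = F (sec (z ^ h) x0).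
    apply: Fst => //; [exact: LJ | exact: pi1J |].
    rewrite conjgM; have -> : (z ^ h) ^ l / z ^ h = [~ z ^ h, l] ^ (z ^ h)^-1.
      by rewrite commgEl !conjgE !gnorm.
    by apply: KJ; [apply: (abC abLK) | apply: sgV => //; apply: LG].
  have := bF (k y) (sec z y) (sec (h * l) y) (dk y) (sigma_sec y nL Lz z1) (Gsec y Ghl).
  rewrite -sec_stabJ // Ehl Ez Ezh.
  by rewrite -GRing.mulr_natr abszM natz absz_nat; lia.
have le_sum : (#|X| * (W * m * `|f|) <= C * (\sum_y k y) + #|X| * b)%N.
  by rewrite -!sum_nat_const big_distrr -big_split /=; apply: leq_sum.
have X_gt0 : 0 < #|X| by apply/card_gt0P; exists x0.
have lecm : (c * m <= #|X|)%N by rewrite cm_A; apply: card_letter_image_le.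
rewrite -(leq_pmul2l X_gt0); apply: leq_trans le_sum _.
rewrite mulnDr leq_add2r mulnCA leq_mul2l; apply/orP; right.
by apply: leq_trans lek _; rewrite leq_mul2r lecm orbT.
Qed.

End PullBack.

Fixpoint letter_image_prod n K : nat :=
  if n is n'.+1 then letter_image_prod n' (sigma K) * #|letter_image K| else 1.

Lemma pull_iter n L K W C b F : normal_in G L -> normal_in G K -> ab_quotient L K ->
  (forall i, letter_trans (iter i sigma L)) ->
  character (iter n sigma L) (iter n sigma K) F ->
  (exists2 u, iter n sigma L u & F u <> 0%R) -> bounded W C b (iter n sigma L) F ->
  exists F', [/\ character L K F', exists2 u, L u & F' u <> 0%R &
     bounded (W * letter_image_prod n K) C b L F'].
Proof.
elim: n L K F => [|n IH] L K F nL nK abLK trL chF Fn0 bF.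
  by exists F; split=> //; rewrite muln1.
have [|||i||||F1 [chF1 F1n0 bF1]] := IH (sigma L) (sigma K) F.
- exact: sigma_normal.
- exact: sigma_normal.
- exact: sigma_ab.
- by rewrite -iterSr; apply: trL.
- by rewrite -!iterSr.
- by rewrite -iterSr.
- by rewrite -iterSr.
have [F' [chF' F'n0 bF']] := pull nL nK abLK (trL 0%N) chF1 F1n0 bF1.
by exists F'; split=> //=; rewrite mulnA.
Qed.

(** * Descent to commutator subgroups *)

Lemma iter_sigma_normal n H : normal_in G H -> normal_in G (iter n sigma H).
Proof. by move=> nH; elim: n => // n IH; apply: sigma_normal. Qed.

Lemma iter_sigma_ab n L K : ab_quotient L K ->
  ab_quotient (iter n sigma L) (iter n sigma K).
Proof. by move=> abLK; elim: n => // n IH; apply: sigma_ab. Qed.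

Lemma iter_sigma_mono n H K : H `<=` K -> iter n sigma H `<=` iter n sigma K.
Proof. by move=> sHK; elim: n => // n IH; apply: sigma_mono. Qed.

Lemma iter_sigma_labels n H k : labels G H k -> labels G (iter n sigma H) k.
Proof. by move=> labH; elim: n => // n IH; apply: sigma_labels. Qed.

Lemma iter_sigma_union (I : Type) n (S : I -> set (tree_aut X)) :
  iter n sigma [set g | exists j, S j g] = [set g | exists j, iter n sigma (S j) g].
Proof.
elim: n => // n IH; rewrite iterS IH; apply/predeqP => g; split.
  by move=> [u [[j Su] u1 Eu]]; exists j; exists u.
by move=> [j [u [Su u1 Eu]]]; exists u; split=> //; exists j.
Qed.

(** Along a word, a trivial action on letters at every stage propagates to a
    trivial action on the whole tree. *)
Lemma sigma_trivial H : normal_in G H ->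
  (forall i u, iter i sigma H u -> pi1 u = 1) -> forall u, H u -> u = 1.
Proof.
move=> nH H1 u Hu; apply: tree_aut_ext => w; elim: w H nH H1 u Hu => [|x w IH] H nH H1 u Hu.
  by rewrite tree_aut_nil.
have u1 := H1 0%N u Hu; rewrite tree_aut_cons u1 perm1.
rewrite (IH (sigma H)) //; [exact: sigma_normal | | exact: sigma_sec].
by move=> i v; rewrite -iterSr; apply: H1.
Qed.

Definition derived L : set (tree_aut X) :=
  [set g | forall H, is_subgroup H -> (forall u v, L u -> L v -> H [~ u, v]) -> H g].

Lemma derived_subgroup L : is_subgroup (derived L).
Proof.
split=> [H sH _|x y dx dy H sH HC|x dx H sH HC]; first exact: sg1.
  by apply: sgM => //; [apply: dx | apply: dy].
by apply: sgV => //; apply: dx.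
Qed.

Lemma derived_ab L : is_subgroup L -> ab_quotient L (derived L).
Proof.
move=> sL; split=> //; first exact: derived_subgroup.
  move=> g; apply=> // u v Lu Lv; rewrite commgEl.
  by apply: sgM => //; [apply: sgV | apply: sgJ].
by move=> u v Lu Lv H _; apply.
Qed.

Lemma derived_normal L : normal_in G L -> normal_in G (derived L).
Proof.
move=> [sL LG LJ]; split; first exact: derived_subgroup.
  by apply: subset_trans LG; apply: abML (derived_ab sL).
move=> u g du Gg H sH HC.
apply: (du [set x | H (x ^ g)]) => [|x y Lx Ly] /=.
  split=> [|x y Hx Hy|x Hx] /=.
  - by rewrite conj1g; exact: sg1.
  - by rewrite conjMg; apply: sgM.
  by rewrite conjVg; apply: sgV.
by rewrite conjRg; apply: HC; apply: LJ.
Qed.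

Lemma derived_min L K : ab_quotient L K -> derived L `<=` K.
Proof. by move=> [sL sK KL LC] g; apply. Qed.

Lemma letter_image_gt0 K : is_subgroup K -> 0 < #|letter_image K|.
Proof.
move=> sK; apply/card_gt0P; exists 1; apply/mem_letter_image.
by exists 1; [exact: sg1 | exact: pi1_one].
Qed.

Lemma letter_image_prodD a b K :
  letter_image_prod (a + b) K =
    (letter_image_prod b (iter a sigma K) * letter_image_prod a K)%N.
Proof.
elim: a K => [|a IH] K /=; first by rewrite muln1.
by rewrite IH -iterSr /= mulnA.
Qed.

Lemma letter_image_prod_gt0 n K : is_subgroup K -> 0 < letter_image_prod n K.
Proof.
elim: n K => //= n IH K sK; rewrite muln_gt0 letter_image_gt0 // IH //.
exact: sigma_subgroup.
Qed.

Lemma letter_image_prod_exp K p n : iter p sigma K = K ->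
  letter_image_prod (n * p) K = (letter_image_prod p K ^ n)%N.
Proof.
by move=> Kp; elim: n => // n IH; rewrite mulSn letter_image_prodD Kp IH expnSr.
Qed.

(** A nontrivial K acts nontrivially on letters at some stage i; all the other
    factors are at least 1. *)
Lemma letter_image_prod_gt1 K : normal_in G K -> ~ (forall u, K u -> u = 1) ->
  exists n, forall k, n <= k -> 1 < letter_image_prod k K.
Proof.
move=> nK ntK.
have [i [u Ku u1]] : exists i, exists2 u, iter i sigma K u & pi1 u <> 1.
  apply: contrapT => no; apply: ntK; apply: (sigma_trivial nK) => i u Ku.
  by apply: contrapT => u1; apply: no; exists i, u.
have sKi : is_subgroup (iter i sigma K) by have [] := iter_sigma_normal i nK.
have [sK _ _] := nK.
exists i.+1 => k /subnKC <-; rewrite -(addn1 i) -addnA 2!letter_image_prodD.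
have lt1 : 1 < letter_image_prod 1 (iter i sigma K).
  rewrite /= mul1n; apply/card_gt1P; exists 1, (pi1 u); split.
  - by apply/mem_letter_image; exists 1; [exact: sg1 | exact: pi1_one].
  - by apply/mem_letter_image; exists u.
  by rewrite eq_sym; apply/eqP.
have gt1 n : 0 < letter_image_prod n (iter 1 sigma (iter i sigma K)).
  by apply: letter_image_prod_gt0; apply: sigma_subgroup.
by have := gt1 (k - (i + 1))%N; have := letter_image_prod_gt0 i sK; move: lt1; nia.
Qed.

Lemma iter_period (T : Type) (f : T -> T) p n (a : T) : iter p f a = a -> iter (n * p) f a = a.
Proof. by move=> fx; elim: n => // n IH; rewrite mulSn iterD IH. Qed.

Hypothesis Gfg : fin_gen G.
Hypothesis Gdl : forall g, G g -> exists n, directed_len n g.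
Hypothesis Gnva : forall L, is_subgroup L -> L `<=` G -> fin_idx G L ->
  ~ (forall u v, L u -> L v -> commute u v).

(** Otherwise L / K would carry a nonzero character. Regard it as a character of
    sigma^(j q) L / sigma^(j q) K, which is the same group, and pull it back: the
    result is integral, nonzero at a generator u of L, and divides its bound at u
    by at least 2^j. *)
Lemma periodic_fin_idx L K p : normal_in G L -> normal_in G K -> ab_quotient L K ->
  fin_idx G L -> (forall i, letter_trans (iter i sigma L)) -> 0 < p ->
  iter p sigma L = L -> iter p sigma K = K -> fin_idx G K.
Proof.
move=> nL nK abLK finL trL p_gt0 Lp Kp; apply: contrapT => ninf.
have [sL LG LJ] := nL.
have Lfg : fin_gen L by apply: Schreier finL.
have [s gens] := Lfg.
have ninfL : ~ fin_idx L K by move=> finK; apply: ninf; apply: fin_idx_trans finK.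
have [F [chF Fn0]] := exists_character abLK Lfg ninfL.
have [C [B bF]] := character_bound nL nK abLK finL chF.
have [N NP] : exists N, forall u, u \in s -> exists2 n, n <= N & directed_len n u.
  have [Ls _] := gens; elim: s Ls {gens} => [|u s IH] Ls; first by exists 0%N.
  have [|N NP] := IH; first by move=> v sv; apply: Ls; rewrite inE sv orbT.
  have [n dn] := Gdl (LG _ (Ls u (mem_head _ _))).
  exists (maxn n N) => v; rewrite inE => /orP[/eqP->|/NP[k lek dk]].
    by exists n; rewrite // leq_maxl.
  by exists k; rewrite // (leq_trans lek) // leq_maxr.
have ntK : ~ (forall u, K u -> u = 1).
  move=> K1; apply: (Gnva sL LG finL) => u v Lu Lv; apply/commgP/eqP/K1.
  exact: (abC abLK).
have [n0 n0P] := letter_image_prod_gt1 nK ntK.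
(* a multiple of the period over which the factor gained exceeds 1 *)
pose q := (n0 * p)%N.
have W_gt1 : 1 < letter_image_prod q K by apply: n0P; rewrite leq_pmulr.
have Lq : iter q sigma L = L by apply: iter_period.
have Kq : iter q sigma K = K by apply: iter_period.
(* 2^j exceeds the bound C N + B valid at all generators *)
pose j := (C * N + B)%N.
have Lqj : iter (j * q) sigma L = L by apply: iter_period.
have Kqj : iter (j * q) sigma K = K by apply: iter_period.
have [|||F' [chF' F'n0 bF']] := @pull_iter (j * q) L K 1 C B F nL nK abLK trL.
- by rewrite Lqj Kqj.
- by rewrite Lqj.
- by rewrite Lqj.
have [u su F'u] := character_neq0_gen sL chF' gens F'n0.
have [n len dn] := NP u su.
have Lu : L u by have [Ls _] := gens; apply: Ls.
have := bF' n u 1 dn Lu (sg1 sG); rewrite conjg1 mul1n letter_image_prod_exp // => le1.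
have : j < letter_image_prod q K ^ j by apply: ltn_expl.
have leC : C * n <= C * N by rewrite leq_mul2l len orbT.
by move: le1 leC F'u; rewrite /j; nia.
Qed.

(** L1 = sigma^i L0 is chosen, for L0 the core of L, so that all its images
    under sigma are transitive on letters and sigma^p L1 = L1. Then
    S j = sigma^(j p) [L1, L1] increases with j, and its union K is fixed by
    sigma^p, so K has finite index; being finitely generated, it is some S j. *)
Lemma descent L M : is_subgroup L -> L `<=` G -> fin_idx G L -> is_subgroup M ->
  (forall u v, L u -> L v -> M [~ u, v]) -> exists n, fin_idx G (iter n sigma M).
Proof.
move=> sL0 LG0 finL0 sM MC.
pose L0 := core G L; have nL0 : normal_in G L0 by apply: core_normal.
have [sLc _ _] := nL0.
have dM : derived L0 `<=` M.
  by move=> g; apply=> // u v Lu Lv; apply: MC; apply: (core_sub sG).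
pose P n := `[<exists m, labels G (iter m sigma L0) n>].
have exP : exists n, P n.
  by have [n labn] := core_fin_idx sG sL0 finL0; exists n; apply/asboolP; exists 0%N.
case: (ex_minnP exP) => N /asboolP[m labN] minN.
pose Ls i := iter (i + m) sigma L0.
have nLs i : normal_in G (Ls i) by apply: iter_sigma_normal.
have labLs i : labels G (Ls i) N.
  by rewrite /Ls iterD; apply: iter_sigma_labels.
have trLs i : letter_trans (Ls i).
  apply: contrapT => ntr; have [sLi LGi _] := nLs i.
  have := labLs i; case: (N) minN => [_ [phi _]|N' minN labLi]; first by case: (phi 1).
  have := sigma_labels_lt sLi LGi labLi ntr => lab'.
  have := minN N'; rewrite ltnn => /(_ _)/negP[] //.
  by apply/asboolP; exists (i.+1 + m)%N.
have [i [p [p_gt0 Eip]]] : exists i p, 0 < p /\ Ls (i + p)%N = Ls i.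
  by apply: (pigeonhole_subgroups sG Gfg _ _ labLs) => i; have [] := nLs i.
pose L1 := Ls i; have nL1 : normal_in G L1 := nLs i.
have [sL1 LG1 _] := nL1.
have Lp : iter p sigma L1 = L1.
  by rewrite /L1 -[in RHS]Eip /Ls -iterD; congr iter; lia.
have finL1 : fin_idx G L1 by exists N; exact: labLs.
have trL1 k : letter_trans (iter k sigma L1) by rewrite /L1 /Ls -iterD addnA; apply: trLs.
have dMi : derived L1 `<=` iter (i + m) sigma M.
  apply: subset_trans (derived_min (iter_sigma_ab (i + m) (derived_ab sLc))) _.
  exact: iter_sigma_mono.
suff [n finn] : exists n, fin_idx G (iter n sigma (derived L1)).
  exists (n + (i + m))%N; rewrite iterD.
  by apply: fin_idx_sub finn; apply: iter_sigma_mono.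
pose S j := iter (j * p) sigma (derived L1).
have LSp j : iter (j * p) sigma L1 = L1 by apply: iter_period.
have abS j : ab_quotient L1 (S j).
  by rewrite -[X in ab_quotient X](LSp j); apply/iter_sigma_ab/derived_ab.
have nS j : normal_in G (S j) by apply/iter_sigma_normal/derived_normal.
have S_mono j k : j <= k -> S j `<=` S k.
  move=> /subnK <-; elim: (k - j)%N => [|n IH] //; apply: subset_trans IH _.
  rewrite /S addSn mulSn [(p + _)%N]addnC iterD; apply: iter_sigma_mono.
  by apply: derived_min; have := abS 1%N; rewrite /S mul1n.
pose K := [set g | exists j, S j g].
have S0 : S 0%N `<=` K by move=> g Sg; exists 0%N.
have nK : normal_in G K.
  split; last first.
  - by move=> u g [j Su] Gg; exists j; have [_ _] := nS j; apply.
  - by move=> u [j Su]; have [_ SG _] := nS j; apply: SG.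
  split; first by apply: S0; have [sS _ _] := nS 0%N; exact: sg1.
    move=> x y [j Sx] [k Sy]; exists (maxn j k); have [sS _ _] := nS (maxn j k).
    by apply: sgM => //; [apply: S_mono Sx | apply: S_mono Sy];
      rewrite ?leq_maxl ?leq_maxr.
  by move=> x [j Sx]; exists j; have [sS _ _] := nS j; apply: sgV.
have [sK KG _] := nK.
have abK : ab_quotient L1 K.
  split=> //; first by move=> g [j Sg]; apply: (abML (abS j)).
  by move=> u v Lu Lv; apply: S0; apply: (abC (abS 0%N)).
have Kp : iter p sigma K = K.
  rewrite /K iter_sigma_union; apply/predeqP => g; split=> -[j Sg].
    by exists j.+1; rewrite /S mulSn iterD.
  by exists j; rewrite -iterD -mulSn; apply: (S_mono j) => //; exact: leqnSn.
have finK : fin_idx G K by apply: (periodic_fin_idx nL1 nK abK finL1 trL1 p_gt0).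
have [t [Kt gent]] := Schreier sG sK KG Gfg finK.
have [j Sj] : exists j, forall g, g \in t -> S j g.
  elim: t Kt {gent} => [|g t IH] Kt; first by exists 0%N.
  have [|j Sj] := IH; first by move=> h th; apply: Kt; rewrite inE th orbT.
  have [k Sk] := Kt g (mem_head _ _).
  exists (maxn j k) => h; rewrite inE => /orP[/eqP->|/Sj Sh].
    by apply: S_mono Sk; rewrite leq_maxr.
  by apply: S_mono Sh; rewrite leq_maxl.
exists (j * p)%N; apply: fin_idx_sub finK; apply: gent => //.
by have [] := nS j.
Qed.

(** * Elementary amenable groups *)

(** A relation R between gT and the automorphisms, seen as a function to sets so
    that sigma applies to its fibers, which is a subgroup of the product. *)
Record subgroup_rel (gT : groupType) (R : gT -> set (tree_aut X)) : Prop := SubgroupRel {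
  rel1 : R 1 1;
  relM : forall x y g h, R x g -> R y h -> R (x * y) (g * h);
  relV : forall x g, R x g -> R x^-1 g^-1
}.

Definition rel_range (T : Type) (R : T -> set (tree_aut X)) : set (tree_aut X) :=
  [set g | exists x, R x g].

Lemma rel_range_subgroup (gT : groupType) (R : gT -> set (tree_aut X)) :
  subgroup_rel R -> is_subgroup (rel_range R).
Proof.
move=> sR; split; first by exists 1; exact: rel1.
  by move=> g h [x Rx] [y Ry]; exists (x * y); apply: relM.
by move=> g [x Rx]; exists x^-1; apply: relV.
Qed.

Lemma rel_fiber_subgroup (gT : groupType) (R : gT -> set (tree_aut X)) :
  subgroup_rel R -> is_subgroup (R 1).
Proof.
move=> sR; split; first exact: rel1.
  by move=> g h Rg Rh; rewrite -(mulg1 1); apply: relM.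
by move=> g Rg; rewrite -invg1; apply: relV.
Qed.

Lemma sigma_rel (gT : groupType) (R : gT -> set (tree_aut X)) n :
  subgroup_rel R -> subgroup_rel (fun x => iter n sigma (R x)).
Proof.
move=> sR; elim: n => //= n [IH1 IHM IHV]; split.
- by exists 1; split; [exact: IH1 | exact: pi1_one | exact: sec_one].
- move=> x y _ _ [u [Ru u1 <-]] [v [Rv v1 <-]]; exists (u * v).
  by split; [exact: IHM | rewrite pi1M u1 v1 mulg1 | rewrite sec_stabM].
move=> x _ [u [Ru u1 <-]]; exists u^-1.
by split; [exact: IHV | rewrite pi1V u1 invg1 | rewrite sec_stabV].
Qed.

Lemma iter_sigmaG n H : H `<=` G -> iter n sigma H `<=` G.
Proof. by move=> HG; elim: n => //= n IH _ [u [Hu _ <-]]; apply/Gsec/IH. Qed.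

(** In other words, no homomorphic image of a subgroup of gT can account for the
    difference between a finite index subgroup of G and the kernel M = R 1: the
    iterated sections of M recover a subgroup of finite index. *)
Definition rich_fibers (gT : groupType) : Prop :=
  forall R : gT -> set (tree_aut X), subgroup_rel R -> rel_range R `<=` G ->
  fin_idx G (rel_range R) -> exists n, fin_idx G (iter n sigma (R 1)).

Lemma rich_fibers_finite (gT : groupType) : finite_set [set: gT] -> rich_fibers gT.
Proof.
move=> /finite_seqP[s Es] R sR RG finR; exists 0%N.
apply: fin_idx_trans finR _.
have /choice[w wP] : forall g, exists x, rel_range R g -> R x g.
  by move=> g; have [[x Rx]|nR] := pselect (rel_range R g); [exists x | exists 1].
have ws g : w g \in s by have : [set` s] (w g) by rewrite -Es.
eexists; apply: (@labels_fin _ _ (fun g => SeqSub (ws g))) => g h Rg Rh [E].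
by rewrite /= -(mulgV (w h)); apply: relM => //; [rewrite -E; exact: wP | apply: relV; auto].
Qed.

Lemma rich_fibers_abelian (gT : groupType) :
  (forall x y : gT, commute x y) -> rich_fibers gT.
Proof.
move=> ab R sR RG finR.
apply: (descent (rel_range_subgroup sR) RG finR (rel_fiber_subgroup sR)).
move=> u v [x Rx] [y Ry].
have <- : [~ x, y] = 1 by apply/eqP/commgP.
by rewrite !commgEl !conjgE; do ?apply: relM => //; apply: relV.
Qed.

Lemma rich_fibers_subgroup (H gT : groupType) (i : {multiplicative H -> gT}) :
  injective i -> rich_fibers gT -> rich_fibers H.
Proof.
move=> i_inj Qg R sR RG finR.
pose R' y g := exists2 x, i x = y & R x g.
have i1 := morph_one (@gmulfM _ _ i); have iV := morph_inv (@gmulfM _ _ i).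
have sR' : subgroup_rel R'.
  split; first by exists 1 => //; exact: rel1.
    by move=> _ _ g h [x <- Rx] [y <- Ry]; exists (x * y); [exact: gmulfM | exact: relM].
  by move=> _ g [x <- Rx]; exists x^-1; [exact: iV | exact: relV].
have ER : rel_range R' = rel_range R.
  by apply/predeqP => g; split=> [[y [x _ Rx]]|[x Rx]]; [exists x | exists (i x), x].
have <- : R' 1 = R 1.
  apply/predeqP => g; split=> [[x x1 Rx]|Rg]; last by exists 1.
  by have <- : x = 1 by apply: i_inj; rewrite i1.
by apply: Qg; rewrite ?ER.
Qed.

Lemma rich_fibers_quotient (gT Q : groupType) (p : {multiplicative gT -> Q}) :
  surjective p -> rich_fibers gT -> rich_fibers Q.
Proof.
move=> p_surj Qg R sR RG finR; pose R' x := R (p x).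
have p1 := morph_one (@gmulfM _ _ p); have pV := morph_inv (@gmulfM _ _ p).
have sR' : subgroup_rel R'.
  split; rewrite /R'; first by rewrite p1; exact: rel1.
    by move=> x y g h Rx Ry; rewrite gmulfM; apply: relM.
  by move=> x g Rx; rewrite pV; apply: relV.
have ER : rel_range R' = rel_range R.
  apply/predeqP => g; split=> [[x Rx]|[y Ry]]; first by exists (p x).
  by have [x Ex] := p_surj y; exists x; rewrite /R' Ex.
by have := Qg R' sR'; rewrite ER /R' p1; apply.
Qed.

(** The fiber R1 1 of the image of R in Q is the range of the restriction RN of
    R to N. The property of Q makes sigma^n of that range of finite index, and
    it is the range of the relation x |-> sigma^n (RN x), to which the property
    of N applies. *)
Lemma rich_fibers_extension (N gT Q : groupType)
    (i : {multiplicative N -> gT}) (p : {multiplicative gT -> Q}) :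
  (forall x, p x = 1 <-> exists n, i n = x) ->
  rich_fibers N -> rich_fibers Q -> rich_fibers gT.
Proof.
move=> ker QN QQ R sR RG finR.
have i1 := morph_one (@gmulfM _ _ i); have iV := morph_inv (@gmulfM _ _ i).
have p1 := morph_one (@gmulfM _ _ p); have pV := morph_inv (@gmulfM _ _ p).
pose R1 y g := exists2 x, p x = y & R x g.
have sR1 : subgroup_rel R1.
  split; first by exists 1 => //; exact: rel1.
    by move=> _ _ g h [x <- Rx] [y <- Ry]; exists (x * y); [exact: gmulfM | exact: relM].
  by move=> _ g [x <- Rx]; exists x^-1; [exact: pV | exact: relV].
have ER : rel_range R1 = rel_range R.
  by apply/predeqP => g; split=> [[y [x _ Rx]]|[x Rx]]; [exists x | exists (p x), x].
have [||n finn] := QQ R1 sR1; rewrite ?ER //.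
pose RN x := R (i x).
have sRN : subgroup_rel RN.
  split; rewrite /RN; first by rewrite i1; exact: rel1.
    by move=> x y g h Rx Ry; rewrite gmulfM; apply: relM.
  by move=> x g Rx; rewrite iV; apply: relV.
have ER1 : R1 1 = rel_range RN.
  apply/predeqP => g; split=> [[x /ker[y <-] Rx]|[y Ry]]; first by exists y.
  by exists (i y) => //; apply/ker; exists y.
move: finn; rewrite ER1 /rel_range iter_sigma_union => finn.
have [||k fink] := QN _ (sigma_rel n sRN); last 1 first.
- by exists (k + n)%N; move: fink; rewrite -iterD /RN i1.
- by move=> g [x Rx]; apply: (@iter_sigmaG n (RN x)) => // h Rh; apply: RG; exists (i x).
exact: finn.
Qed.

(** Finitely many generators of the range of R are related to elements that all
    come from a single group S j, so R has the same range over S j. *)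
Lemma rich_fibers_limit (d : Order.disp_t) (I : porderType d) (S : directed_system I)
    (H : groupType) (f : forall i, {multiplicative S i -> H}) :
  is_direct_limit f -> (forall i, rich_fibers (S i)) -> rich_fibers H.
Proof.
move=> [f_comp f_surj _] QS R sR RG finR.
have [t [Rt gent]] := Schreier sG (rel_range_subgroup sR) RG Gfg finR.
have [j jP] : exists j, forall g, g \in t -> exists x : S j, R (f j x) g.
  elim: t Rt {gent} => [|g t IH] Rt.
    by have [i0] := index_inhabited S; exists i0.
  have [|j jP] := IH; first by move=> h th; apply: Rt; rewrite inE th orbT.
  have [y Ry] := Rt g (mem_head _ _); have [k [x Ex]] := f_surj y.
  have [l [le_jl le_kl]] := index_directed S j k.
  exists l => h; rewrite inE => /orP[/eqP->|/jP[z Rz]].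
    by exists (ds_map S le_kl x); rewrite f_comp Ex.
  by exists (ds_map S le_jl z); rewrite f_comp.
have f1 := morph_one (@gmulfM _ _ (f j)); have fV := morph_inv (@gmulfM _ _ (f j)).
pose R' x := R (f j x).
have sR' : subgroup_rel R'.
  split; rewrite /R'; first by rewrite f1; exact: rel1.
    by move=> x y g h Rx Ry; rewrite gmulfM; apply: relM.
  by move=> x g Rx; rewrite fV; apply: relV.
have ER : rel_range R' = rel_range R.
  apply/predeqP => g; split=> [[x Rx]|]; first by exists (f j x).
  by apply: gent; [exact: rel_range_subgroup | exact: jP].
by have := QS j R' sR'; rewrite ER /R' f1; apply.
Qed.

Lemma elementary_amenable_rich_fibers (gT : groupType) :
  elementary_amenable gT -> rich_fibers gT.
Proof.
elim=> {gT} [H|H|H gT i i_inj _|H Q p p_surj _|N H Q i p _ _ ker _ QN _ QQ|d I S L f lim _].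
- exact: rich_fibers_finite.
- exact: rich_fibers_abelian.
- exact: rich_fibers_subgroup i_inj.
- exact: rich_fibers_quotient p_surj.
- exact: rich_fibers_extension ker QN QQ.
exact: rich_fibers_limit lim.
Qed.

(** For the graph of the embedding f the fiber over 1 is trivial, so a finite
    index would make G finite. *)
Lemma not_elementary_amenable (gT : groupType) (f : gT -> tree_aut X) :
  {morph f : x y / x * y} -> injective f -> range f = G -> ~ elementary_amenable gT.
Proof.
move=> fM f_inj fG /elementary_amenable_rich_fibers Qg.
have f1 := morph_one fM.
have [|||n finn] := Qg (fun x => [set f x]).
- by split=> [|x y _ _ -> ->|x _ ->] /=; [rewrite f1 | rewrite fM | rewrite (morph_inv fM)].
- by move=> _ [x ->]; rewrite -fG; exists x.
- suff -> : rel_range (fun x => [set f x]) = G by apply: fin_idx_id.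
  rewrite -fG; apply/predeqP => g; split=> [[x ->]|[x _ <-]]; first by exists x.
  by exists x.
have triv : iter n sigma [set f 1] `<=` [set 1].
  elim: n {finn} => [|n IH] g /=; first by rewrite f1.
  by move=> [u [/IH -> _ <-]]; rewrite /= sec_one.
apply: (@Gnva [set 1]); last by move=> u v -> ->.
- by split=> [|_ _ -> ->|_ ->] //=; [rewrite mulg1 | rewrite invg1].
- by move=> _ ->; apply: sg1.
exact: fin_idx_sub triv finn.
Qed.

End SelfReplicating.

(** * The theorem *)

Lemma finite_range_labels (T U : Type) (x0 : T) n (phi : T -> 'I_n) (f : T -> U) :
  (forall x y, phi x = phi y -> f x = f y) -> finite_set (range f).
Proof.
move=> phiP.
have /choice[r rP] : forall i : 'I_n, exists x, forall y, phi y = i -> phi x = i.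
  move=> i; have [[x <-]|noi] := pselect (exists x, phi x = i); first by exists x.
  by exists x0 => y yi; case: noi; exists y.
apply: (@sub_finite_set _ _ ((f \o r) @` [set: 'I_n])).
  move=> _ [x _ <-]; exists (phi x) => //=; apply: phiP; exact: (rP _ x).
by apply: finite_image; exact: finite_finset.
Qed.

Lemma virtually_abelian_labels (gT : groupType) (G : groupClosed gT) (L : set gT) :
  is_subgroup L -> fin_idx [set g | g \in G] L ->
  (forall u v, L u -> L v -> commute u v) -> virtually_abelian (subgroup_of G).
Proof.
move=> sL [n [phi phiP]] Lab.
have vM : {morph (@subgroup_val gT G) : x y / x * y} by move=> x y; exact: valM.
have [v1 vV] := (morph_one vM, morph_inv vM).
have sL' : is_subgroup [set x : subgroup_of G | L (subgroup_val x)].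
  split=> [|x y Lx Ly|x Lx]; first by have := sg1 sL; rewrite -v1.
    by have := sgM sL Lx Ly; rewrite -vM.
  by have := sgV sL Lx; rewrite -vV.
exists (subgroup_closed sL').
  move=> x y /subgroup_closedP Lx /subgroup_closedP Ly; apply: val_inj.
  exact: etrans (vM x y) (etrans (Lab _ _ Lx Ly) (esym (vM y x))).
apply: (@finite_range_labels _ _ 1 n (fun x => phi (subgroup_val x))) => x y E.
have Lxy : L (subgroup_val x / subgroup_val y).
  by apply: phiP => //; [case: (x) | case: (y)].
have vD (a b : subgroup_of G) : subgroup_val (a / b) = subgroup_val a / subgroup_val b.
  by rewrite vM vV.
apply/predeqP => z; split=> /subgroup_closedP Lz; apply/subgroup_closedP.
  have Lzx : L (subgroup_val z / subgroup_val x) := eq_ind _ L Lz _ (vD z x).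
  apply: (eq_ind_r L _ (vD z y)).
  by have := sgM sL Lzx Lxy; rewrite !gnorm.
have Lzy : L (subgroup_val z / subgroup_val y) := eq_ind _ L Lz _ (vD z y).
apply: (eq_ind_r L _ (vD z x)).
by have := sgD sL Lzy Lxy; rewrite !gnorm.
Qed.

Theorem theorem1p12 (X : finType) (hX : 1 < #|X|) (G : groupClosed (tree_aut X))
    (hrep : self_replicating G) (hawt : abelian_wreath_type G) :
  virtually_abelian (subgroup_of G) \/ ~ elementary_amenable (subgroup_of G).
Proof.
have [va|nva] := pselect (virtually_abelian (subgroup_of G)); [by left | right].
have [x0 _] : exists x0 : X, true by case/card_gt0P: (ltnW hX) => x0; exists x0.
have [Gss Gtr Grep] := hrep; have [abG [Y [/finite_seqP[s YE] Yss [YG genY] Ytype]]] := hawt.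
pose Gs : set (tree_aut X) := [set g | g \in G].
have sG : is_subgroup Gs.
  by split=> [|x y|x]; [exact: gpred1 | exact: gpredM | exact: gpredVr].
have Gsec g x : Gs g -> Gs (sec g x) by move=> Gg; apply: Gss.
have Glift x h : Gs h -> exists g, [/\ Gs g, pi1 g x = x & sec g x = h].
  move=> Gh; have [g [Gg gx gh]] := (Grep x h).2 Gh; exists g; split=> //.
  by move: gx; rewrite pi1E => -[].
have Gab g h : Gs g -> Gs h -> commute (pi1 g) (pi1 h).
  move=> Gg Gh; apply: (centsP abG); rewrite inE; apply/asboolP.
    by exists g.
  by exists h.
pose D := [seq t <- s ++ [seq t^-1 | t <- s] | `[<directed_in Gs t>]].
have DP t : t \in D -> directed_in Gs t by rewrite mem_filter => /andP[/asboolP].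
have DV t : t \in D -> t^-1 \in D.
  rewrite !mem_filter !mem_cat => /andP[/asboolP dt /orP st]; apply/andP; split.
    exact/asboolP/directedV.
  apply/orP; case: st => [st|/mapP[u su ->]]; last by left; rewrite invgK.
  by right; apply/mapP; exists t.
have Ys y : Y y <-> y \in s by rewrite YE.
have Gfg : fin_gen Gs.
  exists s; split=> [y /Ys|H sH Hs]; first exact: YG.
  move=> g Gg; apply/(subgroup_closedP sH); apply: genY Gg => y /Ys/Hs Hy.
  exact/subgroup_closedP.
have Gdl g : Gs g -> exists n, directed_len Gs D n g.
  have sdl : is_subgroup [set g | exists n, directed_len Gs D n g].
    split=> [|x y [m dm] [n dn]|x [n dn]]; first by exists 0%N; exact: dl1.
      by exists (n + m)%N; exact: directed_len_mul.
    by exists n; apply: directed_len_inv.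
  move=> Gg; apply/(subgroup_closedP sdl); apply: genY Gg => y Yy.
  apply/subgroup_closedP => /=; have Gy := YG y Yy.
  have [y1|[yx [x [yxy uniq_x]]]] := Ytype y Yy.
    by exists 0%N; rewrite -(mul1g y); apply: dlR; [exact: dl1 | split].
  exists 1%N; rewrite -(mul1g y); apply: dlD; first exact: dl1.
  rewrite mem_filter mem_cat; apply/andP; split; last by rewrite (Ys y).1.
  apply/asboolP; split=> //; exists x => // z zx; split; first exact: Gsec.
  have [yz|[t _ yz]] := yx z; first by rewrite (uniq_x z yz) eqxx in zx.
  by move=> w; rewrite /sec in yz *; rewrite yz; exact: sec_rooted.
apply: (@not_elementary_amenable X Gs x0 sG Gsec Gtr Glift Gab D DP Gfg Gdl _
  (subgroup_of G) (@subgroup_val _ G)).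
- move=> L sL _ finL Lab; apply: nva; exact: virtually_abelian_labels sL finL Lab.
- by move=> x y; exact: valM.
- exact: val_inj.
apply/predeqP => g; split=> [[x _ <-]|Gg]; first by case: x.
by exists (SubgroupOf Gg).
Qed.
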